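(* Let $n\ge1$ and $c$ be integers with $c\ge\lfloor n/2\rfloor$, and let $\mathbf{s}_n\in\mathcal{B}(n,c)$. If $c\ge c_0=\lfloor 3n/4\rfloor$, then $\mathbf{s}_n\in\mathcal{R}(n,c)$ and $nlc(\mathbf{s}_n^\infty)=nlc(\mathbf{s}_n)+add(\mathbf{s}_n)$. Moreover, for even $n$ the tight bound is $$c_0=\begin{cases}\lfloor 3n/4\rfloor-1,& n=8k,\\ \lfloor 3n/4\rfloor,& n=8k+2 \text{ or } n=8k+6,\\ \lfloor 3n/4\rfloor-2,& n=8k+4,\ k\ge2,\end{cases}$$ (with $k$ a nonnegative integer) in the sense that every sequence in $\mathcal{B}(n,c)$ with $c\ge c_0$ belongs to $\mathcal{R}(n,c)$, and (when $c_0-1\ge\lfloor n/2\rfloor$) there exists a sequence in $\mathcal{B}(n,c_0-1)$ that does not belong to $\mathcal{R}(n,c_0-1)$.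
   Context: All sequences are binary (entries in $\mathbb{Z}_2$), $\overline{x}=x\oplus1$, $x\bmod d$ is the least nonnegative residue, and $\mathbf{a}^q$ is the concatenation of $q$ copies of $\mathbf a$. For $\mathbf{s}_n=(s_0,\dots,s_{n-1})$, $\mathbf{s}_j=(s_0,\dots,s_{j-1})$ and $\mathbf{s}_n^\infty$ is the infinite periodic sequence obtained by repeating $\mathbf{s}_n$. A length-$m$ sequence is periodic if it is the concatenation of $m/e$ copies of a length-$e$ sequence for a proper divisor $e$ of $m$, aperiodic otherwise. $nlc(\mathbf{u})$ (nonlinear complexity) of a finite or infinite sequence $\mathbf u$ is the least $L\ge0$ such that some $f:\mathbb{Z}_2^L\to\mathbb{Z}_2$ satisfies $u_{i+L}=f(u_i,\dots,u_{i+L-1})$ for all $i$ for which $u_{i+L}$ is defined. Right circular shift: $R^k(\mathbf{s}_n)=(s_{n-k},\dots,s_{n-1},s_0,\dots,s_{n-k-1})$, $0\le k<n$. For $c\ge\lfloor n/2\rfloor$ and $1\le d\le\min\{n-c,\lfloor n/2\rfloor\}$, $\mathcal{B}(n,c,d)$ is the set of aperiodic length-$n$ sequences $\mathbf{s}_n$ with $\mathbf{s}_d$ aperiodic and $\mathbf{s}_{c+d}=(s_0,\dots,s_{d-1})^q(s_0,\dots,s_{r-1},\overline{s_r})$, where $q=\lfloor(c+d-1)/d\rfloor$, $r=c+d-1-qd$, and $s_{c+d},\dots,s_{n-1}$ are arbitrary; $d$ is called the spacing. $\mathcal{B}(n,c)=\bigcup_{d=1}^{\min\{n-c,\lfloor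 n/2\rfloor\}}\mathcal{B}(n,c,d)$. For $\mathbf{s}_n\in\mathcal{B}(n,c,d)$, $add(\mathbf{s}_n)$ is the integer $t\ge0$ such that $s_{n-1-i}=s_{(d-1-i)\bmod d}$ for $0\le i<t$ and $s_{n-1-t}\neq s_{(d-1-t)\bmod d}$. For $\mathbf{s}_n\in\mathcal{B}(n,c)$, $E(\mathbf{s}_n)=\{R^k(\mathbf{s}_n):0\le k<n\}\cap\mathcal{B}(n,c)$; an element $\tilde{\mathbf s}\in E(\mathbf{s}_n)$ is a (sequence) representative of $\mathbf{s}_n$ if $add(\tilde{\mathbf s})\ge add(\mathbf{a})$ for all $\mathbf a\in E(\mathbf{s}_n)$. $\mathcal{R}(n,c)$ is the set of all representatives in $\mathcal{B}(n,c)$, i.e. all $\mathbf{s}\in\mathcal{B}(n,c)$ with $add(\mathbf{s})\ge add(\mathbf a)$ for every $\mathbf a\in E(\mathbf s)$. *)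

(* Defs.v *)
From Stdlib Require Import ClassicalEpsilon.
From mathcomp Require Import all_boot.

Set Implicit Arguments.
Unset Strict Implicit.
Unset Printing Implicit Defensive.

Definition periodic (s : seq bool) : bool :=
  has (fun e => (e %| size s) && (s == flatten (nseq (size s %/ e) (take e s))))
      (iota 1 (size s).-1).

Definition aperiodic (s : seq bool) : bool := ~~ periodic s.

(* Membership in B(n,c,d) (the standing requirement c >= floor(n/2) is part of
   the membership in B(n,c), see [inBc]). *)
Definition inB (n c d : nat) (s : seq bool) : bool :=
  let q := (c + d).-1 %/ d in
  let r := (c + d).-1 - q * d in
  [&& size s == n, 1 <= d, d <= minn (n - c) n./2,
      aperiodic s, aperiodic (take d s) &
      take (c + d) s ==
        flatten (nseq q (take d s)) ++ rcons (take r s) (~~ nth false s r)].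

Definition inBc (n c : nat) (s : seq bool) : bool :=
  (n./2 <= c) && has (fun d => inB n c d s) (iota 1 (minn (n - c) n./2)).

(* add(s) for s in B(n,c,d): the least t such that
   s_{n-1-t} <> s_{(d-1-t) mod d}, where (d-1-t) mod d = d-1 - (t mod d). *)
Definition add_d (d : nat) (s : seq bool) : nat :=
  let n := size s in
  find (fun t => nth false s (n.-1 - t) != nth false s (d.-1 - t %% d)) (iota 0 n).

(* The spacing of s in B(n,c) (the d with s in B(n,c,d); it is unique). *)
Definition spacing (n c : nat) (s : seq bool) : nat :=
  nth 0 [seq d <- iota 1 n | inB n c d s] 0.

Definition add (n c : nat) (s : seq bool) : nat := add_d (spacing n c s) s.

Definition Rshift (k : nat) (s : seq bool) : seq bool := rotr k s.

Definition inRc (n c : nat) (s : seq bool) : Prop :=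
  inBc n c s /\
  forall k, k < n -> inBc n c (Rshift k s) -> add n c (Rshift k s) <= add n c s.

Definition pb (P : Prop) : bool := if excluded_middle_informative P then true else false.

Lemma pbP (P : Prop) : P -> pb P.
Proof. by rewrite /pb; case: excluded_middle_informative. Qed.

Definition admits_fin (u : seq bool) (L : nat) : Prop :=
  exists f : seq bool -> bool,
    forall i, i + L < size u -> nth false u (i + L) = f (take L (drop i u)).

Definition admits_inf (u : nat -> bool) (L : nat) : Prop :=
  exists f : seq bool -> bool,
    forall i, u (i + L) = f (mkseq (fun j => u (i + j)) L).

Definition per_ext (s : seq bool) : nat -> bool := fun i => nth false s (i %% size s).

Lemma admits_fin_ex (u : seq bool) : exists L, pb (admits_fin u L).
Proof.
exists (size u); apply: pbP; exists (fun _ => false) => i.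
by rewrite ltnNge leq_addl.
Qed.

Lemma admits_per_ex (s : seq bool) : exists L, pb (admits_inf (per_ext s) L).
Proof.
exists (size s); apply: pbP; exists (head false) => i.
rewrite /per_ext; case: s => [|b s'] /=.
  by rewrite !nth_nil.
by rewrite addn0 modnDr.
Qed.

Definition nlc (u : seq bool) : nat := ex_minn (admits_fin_ex u).
Definition nlc_per (s : seq bool) : nat := ex_minn (admits_per_ex s).

Definition c0_even (n : nat) : nat :=
  if n %% 8 == 0 then (3 * n) %/ 4 - 1
  else if n %% 8 == 4 then (3 * n) %/ 4 - 2
  else (3 * n) %/ 4.

(* Main.v *)
(* Two maximal repeats of spacings d and e in the cyclic word s become, modulo
   X^n - 1, identities S (X^d - 1) = X^p P and S (X^e - 1) = X^q Q in Z[X], where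
   P and Q have degree at most n - c and the degree of P is n - c - add.  Hence
   P (X^e - 1) and Q (X^d - 1) agree up to a cyclic shift.  Either they are equal,
   and then Bezout applied to X^gcd(d,e) - 1 shows that gcd(d,e) is a period of
   both repeats (a Fine-Wilf argument), so that d = e by primitivity; or the
   arcs supporting them wrap around the circle and overlap in two short pieces
   A and B, both divisible by X^gcd(d,e) - 1.  Comparing A and B modulo X^e - 1
   and X^d - 1 forces n = 2d + 2e in general, which needs a large n - c; this
   second case yields both the bound and the words showing that it is tight. *)
Require Import Defs.
From mathcomp Require Import all_boot all_algebra zify ring.

Set Implicit Arguments.
Unset Strict Implicit.
Unset Printing Implicit Defensive.

Import GRing.Theory.
Import Defs.

(** * Polynomials modulo X^n - 1 *)

Section CyclicPolynomials.
Local Open Scope ring_scope.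
Variable R : idomainType.
Implicit Types (S P Q F G H A B : {poly R}) (n d e g p q r : nat).

(** As long as 2(n - c) <= n, the difference polynomials of one spacing at two mismatches are cyclic
    shifts of each other and have equal sizes, and [add] is read off the size. A word can therefore
    miss R(n,c) only if one of its rotations lies in B(n,c) with another spacing, so the question is
    about two distinct spacings d and e. The obstacle is that the two runs need not share a segment
    of length d + e: two arcs of about 3n/4 letters on a circle of n may overlap in two separate
    pieces, neither of which suffices for Fine-Wilf. Polynomials keep both pieces in one identity:
    over an integral domain X^n - 1 can be cancelled and sizes of products add up, so the overlaps
    obey exact linear equations. The complexities follow from the same dichotomy, applied to an
    arbitrary repeat against the run of s. Counting leaves open (n,c) = (5,3), (8,5), (9,6) and, for
    the spacings 6 and 7, (20,13); these are enumerated. *)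

Definition Xn1dvd n F := exists K, F = K * ('X^n - 1).

Lemma Xn1dvd0 n : Xn1dvd n 0.
Proof. by exists 0; rewrite mul0r. Qed.

Lemma Xn1dvdD n F G : Xn1dvd n F -> Xn1dvd n G -> Xn1dvd n (F + G).
Proof. by move=> [K ->] [L ->]; exists (K + L); rewrite mulrDl. Qed.

Lemma Xn1dvdM n F G : Xn1dvd n G -> Xn1dvd n (F * G).
Proof. by move=> [K ->]; exists (F * K); rewrite mulrA. Qed.

Lemma Xn1dvdN n F : Xn1dvd n F -> Xn1dvd n (- F).
Proof. by move=> [K ->]; exists (- K); rewrite mulNr. Qed.

Lemma Xn1dvdB n F G : Xn1dvd n F -> Xn1dvd n G -> Xn1dvd n (F - G).
Proof. by move=> hF hG; apply: Xn1dvdD hF (Xn1dvdN hG). Qed.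

Lemma Xn1dvd_Xn1 g d : (g %| d)%N -> Xn1dvd g ('X^d - 1).
Proof.
move=> /dvdnP[k ->]; rewrite mulnC exprM (subrX1 ('X^g : {poly R}) k).
by exists (\sum_(i < k) 'X^g ^+ i); rewrite mulrC.
Qed.

Lemma Xn1dvd_Xmod n p q : p = q %[mod n] -> Xn1dvd n ('X^p - 'X^q).
Proof.
wlog le_pq : p q / (p <= q)%N => [hw|] epq.
  case: (leqP p q) => [|/ltnW] h; first exact: hw.
  by rewrite -opprB; apply: Xn1dvdN; apply: hw.
have /Xn1dvd_Xn1 hd : (n %| q - p)%N by rewrite -eqn_mod_dvd // epq.
rewrite -(subnKC le_pq) -opprB exprD -{2}['X^p]mulr1 -mulrBr.
exact/Xn1dvdN/Xn1dvdM.
Qed.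

(** This bound turns congruences into equalities: two polynomials of size at most n that agree
    modulo X^n - 1 are equal. *)
Lemma size_Xn1dvd n F : (0 < n)%N -> Xn1dvd n F -> F != 0 -> (n < size F)%N.
Proof.
move=> n0 [K ->]; rewrite mulf_eq0 negb_or => /andP[K0 X0].
rewrite size_mul // size_Xn_sub_1 // addnS /=.
by rewrite -[ltnLHS]add0n ltn_add2r size_poly_gt0.
Qed.

Lemma size_mulXn1 P e : P != 0 -> (0 < e)%N ->
  size (P * ('X^e - 1)) = (size P + e)%N.
Proof.
move=> P0 e0; rewrite size_mul // ?size_Xn_sub_1 ?addnS //.
by rewrite -size_poly_gt0 size_Xn_sub_1.
Qed.

Lemma coef0_neq0 P : P`_0 != 0 -> P != 0.
Proof. by apply: contraNneq => ->; rewrite coef0. Qed.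

Lemma coef0_mulXn1 P e : (0 < e)%N -> (P * ('X^e - 1))`_0 = - P`_0.
Proof. by case: e => // e _; rewrite coefM big_ord1 !coefE /= sub0r mulrN1. Qed.

(* In the second case the arcs supporting F and X^q G cover the circle and meet in
   two pieces, which carry A and X^q B. *)
Lemma cyclic_shift_cases n q F G :
  (q < n)%N -> (size F <= n)%N -> (size G <= n)%N -> F`_0 != 0 -> G`_0 != 0 ->
  Xn1dvd n (F - 'X^q * G) ->
  (q = 0%N /\ F = G) \/
  exists A B, [/\ (0 < q)%N, A`_0 != 0 /\ B`_0 != 0,
    F = A + 'X^q * B, G = B + 'X^(n - q) * A &
    size F = (q + size B)%N /\ size G = (n - q + size A)%N].
Proof.
move=> qn sF sG F0 G0 hd.
(* [A] is the part of G that X^q pushes past degree n, so that it wraps to the beginning of F; [B]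
   is the part that stays. *)
pose A := drop_poly (n - q) G; pose B := take_poly (n - q) G.
have eG : G = B + 'X^(n - q) * A.
  by rewrite [in LHS](esym (poly_take_drop (n - q) G)) mulrC.
have Xnsplit : ('X^n : {poly R}) = 'X^q * 'X^(n - q).
  by rewrite -exprD subnKC // ltnW.
have sB : (size B <= n - q)%N by apply: size_take_poly.
have eF : F = A + 'X^q * B.
  apply/eqP; rewrite -subr_eq0; apply/negP => /negP nz.
  have hd2 : Xn1dvd n (F - (A + 'X^q * B)).
    have -> : F - (A + 'X^q * B) = F - 'X^q * G + A * ('X^n - 1).
      rewrite eG Xnsplit; ring.
    by apply: Xn1dvdD => //; exists A.
  have := size_Xn1dvd (leq_ltn_trans (leq0n _) qn) hd2 nz.
  rewrite ltnNge => /negP; apply.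
  apply: leq_trans (size_polyD _ _) _; rewrite geq_max sF size_polyN.
  apply: leq_trans (size_polyD _ _) _; rewrite geq_max.
  rewrite size_drop_poly (leq_trans (leq_subr _ _) sG) /=.
  have [->|B0] := eqVneq B 0; first by rewrite mulr0 size_poly0.
  by rewrite mulrC size_mulXn // -leq_subRL // ltnW.
case: (posnP q) => [q0|q0]; [left|right].
  split=> //; rewrite eF eG q0 subn0 /A drop_poly_eq0 ?q0 ?subn0 //.
  by rewrite expr0 mul1r mulr0 add0r addr0.
have A0 : A`_0 != 0 by move: F0; rewrite eF coefD coefXnM q0 addr0.
have B0 : B`_0 != 0 by rewrite coef_take_poly subn_gt0 qn.
have sA : (size A <= q)%N by rewrite size_drop_poly; lia.
exists A, B; split=> //.
have [An0 Bn0] := (coef0_neq0 A0, coef0_neq0 B0).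
split.
  rewrite eF addrC size_polyDl mulrC size_mulXn //.
  by move: Bn0; rewrite -size_poly_gt0; lia.
rewrite eG addrC size_polyDl mulrC size_mulXn //.
by move: An0; rewrite -size_poly_gt0; lia.
Qed.

(** Bezout in the exponents is enough: if a d = b e + g, then X^g - 1 = (X^(a d) - 1) - X^g (X^(b e)
    - 1). *)
Lemma Xn1_bezout d e : (0 < d)%N ->
  exists u v : {poly R}, 'X^(gcdn d e) - 1 = u * ('X^d - 1) + v * ('X^e - 1).
Proof.
move=> d0; case: (egcdnP e d0) => kd ke Hk _.
have [a ha] := Xn1dvd_Xn1 (dvdn_mull kd (dvdnn d)).
have [b hb] := Xn1dvd_Xn1 (dvdn_mull ke (dvdnn e)).
exists a, (- ('X^(gcdn d e) * b)).
rewrite mulNr -mulrA -ha -hb Hk exprD; ring.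
Qed.

(** Up to powers of X, both P (X^e - 1) and Q (X^d - 1) are S (X^d - 1) (X^e - 1) modulo X^n - 1, so
    [cyclic_shift_cases] compares them. In the unwrapped case H acts as a difference polynomial of
    spacing gcd(d,e). *)
Lemma two_differences n d e p q S P Q :
  (0 < n)%N -> (0 < d)%N -> (0 < e)%N -> P`_0 != 0 -> Q`_0 != 0 ->
  (size P + e <= n)%N -> (size Q + d <= n)%N ->
  Xn1dvd n (S * ('X^d - 1) - 'X^p * P) ->
  Xn1dvd n (S * ('X^e - 1) - 'X^q * Q) ->
  (p = q %[mod n] /\ exists H,
     [/\ P * ('X^(gcdn d e) - 1) = H * ('X^d - 1),
         Q * ('X^(gcdn d e) - 1) = H * ('X^e - 1) &
         Xn1dvd n (S * ('X^(gcdn d e) - 1) - 'X^p * H)]) \/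
  exists r A B,
    [/\ (0 < r < n)%N /\ (A`_0 != 0 /\ B`_0 != 0),
        P * ('X^e - 1) = A + 'X^r * B, Q * ('X^d - 1) = B + 'X^(n - r) * A,
        (size P + e = r + size B)%N /\ (size Q + d = n - r + size A)%N &
        Xn1dvd (gcdn d e) A /\ Xn1dvd (gcdn d e) B].
Proof.
move=> n0 d0 e0 P0 Q0 sP sQ hP hQ.
have [Pn0 Qn0] := (coef0_neq0 P0, coef0_neq0 Q0).
(* [m] cancels the offset p modulo n, leaving a single relative offset [r]. *)
pose m := (n - p %% n)%N; pose r := ((q + m) %% n)%N.
have rn : (r < n)%N by rewrite ltn_mod.
have pm0 : (p + m = 0 %[mod n])%N.
  by rewrite -modnDml /m subnKC ?modnn ?mod0n // ltnW // ltn_mod.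
have [U hU] : Xn1dvd n ('X^m * S * ('X^d - 1) - P).
  have -> : 'X^m * S * ('X^d - 1) - P =
     'X^m * (S * ('X^d - 1) - 'X^p * P) + P * ('X^(p + m) - 'X^0).
    rewrite exprD expr0; ring.
  by apply: Xn1dvdD; apply: Xn1dvdM => //; apply: Xn1dvd_Xmod.
have [V hV] : Xn1dvd n ('X^m * S * ('X^e - 1) - 'X^r * Q).
  have -> : 'X^m * S * ('X^e - 1) - 'X^r * Q =
     'X^m * (S * ('X^e - 1) - 'X^q * Q) + Q * ('X^(q + m) - 'X^r).
    rewrite exprD; ring.
  by apply: Xn1dvdD; apply: Xn1dvdM => //; apply: Xn1dvd_Xmod; rewrite modn_mod.
have cross : P * ('X^e - 1) - 'X^r * (Q * ('X^d - 1)) =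
    (V * ('X^d - 1) - U * ('X^e - 1)) * ('X^n - 1).
  have -> : (V * ('X^d - 1) - U * ('X^e - 1)) * ('X^n - 1) =
    (V * ('X^n - 1)) * ('X^d - 1) - (U * ('X^n - 1)) * ('X^e - 1) by ring.
  rewrite -hU -hV; ring.
have := @cyclic_shift_cases n r (P * ('X^e - 1)) (Q * ('X^d - 1)) rn.
rewrite !size_mulXn1 // !coef0_mulXn1 // !oppr_eq0 => /(_ sP sQ P0 Q0).
case; first by exists (V * ('X^d - 1) - U * ('X^e - 1)).
  move=> [r0 eFG]; left.
  have epq : p = q %[mod n].
    apply/eqP; rewrite -(eqn_modDr m) pm0 mod0n -/r r0 //.
  split=> //; have [u [v uv]] := @Xn1_bezout d e d0.
  (* The combination that makes X^g - 1 from X^d - 1 and X^e - 1 makes H from P and Q. *)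
  exists (u * P + v * Q); rewrite uv; split.
  - have -> : P * (u * ('X^d - 1) + v * ('X^e - 1)) =
      u * P * ('X^d - 1) + v * (P * ('X^e - 1)) by ring.
    rewrite eFG; ring.
  - have -> : Q * (u * ('X^d - 1) + v * ('X^e - 1)) =
      v * Q * ('X^e - 1) + u * (Q * ('X^d - 1)) by ring.
    rewrite -eFG; ring.
  - have -> : S * (u * ('X^d - 1) + v * ('X^e - 1)) - 'X^p * (u * P + v * Q)
      = u * (S * ('X^d - 1) - 'X^p * P) + v * (S * ('X^e - 1) - 'X^q * Q)
        + (- (v * Q)) * ('X^p - 'X^q) by ring.
    by do 2?apply: Xn1dvdD; apply: Xn1dvdM => //; apply: Xn1dvd_Xmod.
move=> [A [B [r0 [A0 B0] eF eG [szF szG]]]]; right; exists r, A, B.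
(* When wrapped, the left side of [cross] is -A (X^n - 1); cancelling X^n - 1 leaves A in the ideal
   of X^d - 1 and X^e - 1. *)
have eA : A = U * ('X^e - 1) - V * ('X^d - 1).
  have Xn0 : ('X^n - 1 : {poly R}) != 0.
    by rewrite -size_poly_gt0 size_Xn_sub_1.
  apply: (mulIf Xn0).
  have -> : (U * ('X^e - 1) - V * ('X^d - 1)) * ('X^n - 1) =
    - ((V * ('X^d - 1) - U * ('X^e - 1)) * ('X^n - 1)) by ring.
  rewrite -cross eF eG -(subnKC (ltnW rn)) exprD addKn; ring.
have gA : Xn1dvd (gcdn d e) A.
  rewrite eA; apply: Xn1dvdB; apply: Xn1dvdM; apply: Xn1dvd_Xn1.
    exact: dvdn_gcdr.
  exact: dvdn_gcdl.
split=> //; first by rewrite r0.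
split=> //.
have -> : B = Q * ('X^d - 1) - 'X^(n - r) * A by rewrite eG; ring.
apply: Xn1dvdB; apply: Xn1dvdM => //.
by apply: Xn1dvd_Xn1; apply: dvdn_gcdl.
Qed.

(** If the pieces wrapped again modulo X^e - 1, their sizes would add up to at least e + 2. They can
    thus only cancel each other, at offset 0 modulo e. *)
Lemma short_cyclic_shift e r A B :
  (0 < e)%N -> A`_0 != 0 -> B`_0 != 0 -> Xn1dvd e (A + 'X^r * B) ->
  (size A + size B <= e.+1)%N -> (e %| r)%N /\ size A = size B.
Proof.
move=> e0 A0 B0 hd sAB.
have sA := coef0_neq0 A0; have sB := coef0_neq0 B0.
move: sA sB; rewrite -!size_poly_gt0 => sA sB.
have re : (r %% e < e)%N by rewrite ltn_mod.
have := @cyclic_shift_cases e (r %% e)%N A (- B) re.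
rewrite size_polyN coefN oppr_eq0 => /(_ _ _ A0 B0) [||| [r0 ->]|].
- by move: sAB sA sB; move: (size A) (size B); lia.
- by move: sAB sA sB; move: (size A) (size B); lia.
- have -> : A - 'X^(r %% e) * - B = A + 'X^r * B + B * ('X^(r %% e) - 'X^r).
    by ring.
  apply: Xn1dvdD => //; apply: Xn1dvdM; apply: Xn1dvd_Xmod.
  by rewrite modn_mod.
- by rewrite size_polyN; split=> //; rewrite /dvdn r0.
move=> [A' [B' [_ [A'0 B'0] _ _ [sA' sB']]]].
have := coef0_neq0 A'0; have := coef0_neq0 B'0.
rewrite -!size_poly_gt0 sA' sB' in sAB *.
by move: sAB; move: (size A') (size B'); lia.
Qed.

Lemma Xn1dvd_Xcancel n k F : (0 < n)%N -> Xn1dvd n ('X^k * F) -> Xn1dvd n F.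
Proof.
move=> n0 hF.
have -> : F = 'X^(n * k - k) * ('X^k * F) + F * ('X^0 - 'X^(n * k)).
  have -> : ('X^(n * k) : {poly R}) = 'X^(n * k - k) * 'X^k.
    by rewrite -exprD subnK // leq_pmull.
  rewrite expr0; ring.
apply: Xn1dvdD; apply: Xn1dvdM => //; apply: Xn1dvd_Xmod.
by rewrite mod0n modnMr.
Qed.

End CyclicPolynomials.

(** * Difference polynomials of cyclic words *)

Section CyclicWords.
Local Open Scope ring_scope.
Variables (n : nat) (f : nat -> bool).
Hypotheses (n_gt0 : (0 < n)%N) (f_per : forall j, f (j + n)%N = f j).
Implicit Types (a b d e g i j k : nat).

Definition wordp a : {poly int} := \poly_(i < n) (f (a + i)%N)%:R.
(* The coefficient of X^i is nonzero iff f (a + i) <> f (a + i + d): when a is a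
   mismatch, the size is n minus the length of the d-run that ends before a. *)
Definition diffp d a := wordp a - wordp (a + d).

Lemma f_perM j k : f (j + k * n)%N = f j.
Proof. by elim: k => [|k IH]; rewrite ?addn0 // mulSn addnCA addnC f_per. Qed.

Lemma f_mod j k : j = k %[mod n] -> f j = f k.
Proof.
move=> h; rewrite (divn_eq j n) (divn_eq k n) h ![(_ * n + _)%N]addnC.
by rewrite !f_perM.
Qed.

Lemma wordp_perM a k : wordp (a + k * n) = wordp a.
Proof. by apply: eq_poly => i _; rewrite addnAC f_perM. Qed.

Lemma wordp_shift a k : Xn1dvd n ('X^k * wordp (a + k) - wordp a).
Proof.
elim: k a => [|k IH] a; first by rewrite expr0 mul1r addn0 subrr; apply: Xn1dvd0.
have -> : 'X^(k.+1) * wordp (a + k.+1) - wordp a =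
   'X * ('X^k * wordp (a.+1 + k) - wordp a.+1) + ('X * wordp a.+1 - wordp a).
  rewrite exprS addSnnS; ring.
apply: Xn1dvdD; first exact: Xn1dvdM.
(* In one rotation the letter [f a] leaves at X^0 and re-enters at X^n, so the quotient by X^n - 1
   is the constant [f a]. *)
exists (f a)%:R%:P; apply/polyP => i.
rewrite coefB coefXM mulrBr mulr1 coefB coefCM coefXn coefC !coef_poly.
case: i => [|i] /=.
  by rewrite n_gt0 addn0 eq_sym eqn0Ngt n_gt0 mulr0.
rewrite addSnnS subr0; have [->|ni] := eqVneq i.+1 n.
  by rewrite ltnn leqnn f_per subr0 mulr1.
rewrite mulr0; have [lt_in|ge_in] := ltnP i n.
  have -> : (i.+1 < n)%N by lia.
  by rewrite subrr.
by rewrite ltnNge (leqW ge_in) subr0.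
Qed.

Lemma wordp_diff d a :
  Xn1dvd n (wordp a * ('X^d - 1) - 'X^d * diffp d a).
Proof.
have -> : wordp a * ('X^d - 1) - 'X^d * diffp d a =
   'X^d * wordp (a + d) - wordp a by rewrite /diffp; ring.
exact: wordp_shift.
Qed.

Lemma coef_diffp d a i :
  ((diffp d a)`_i == 0) = ((i < n)%N ==> (f (a + i)%N == f (a + i + d)%N)).
Proof.
rewrite coefB !coef_poly addnAC; case: ltnP => _ /=; last by rewrite subrr eqxx.
by case: (f _); case: (f _).
Qed.

Lemma coef0_diffp d a : ((diffp d a)`_0 != 0) = (f a != f (a + d)%N).
Proof. by rewrite coef_diffp n_gt0 addn0. Qed.

Lemma size_diffp_le d a : (size (diffp d a) <= n)%N.
Proof.
by apply/leq_sizeP => i hi; apply/eqP; rewrite coef_diffp ltnNge hi.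
Qed.

(** X^(d - g) H is congruent to the difference polynomial of spacing g, and both have size at most
    n, so they are equal; the size of H then bounds the mismatches at distance g. *)
Lemma diffp_run g a d (H : {poly int}) (m : nat) :
  (size H + d <= m + g)%N -> (g <= d)%N -> (m <= n)%N ->
  Xn1dvd n (wordp a * ('X^g - 1) - 'X^d * H) ->
  forall i, (m <= i < n)%N -> f (a + i)%N = f (a + i + g)%N.
Proof.
move=> sH gd mn hH.
have sXH : (size ('X^(d - g) * H)%R <= m)%N.
  have [->|H0] := eqVneq H 0; first by rewrite mulr0 size_poly0.
  by rewrite mulrC size_mulXn //; lia.
suff eD : diffp g a = 'X^(d - g) * H.
  move=> i /andP[mi i_n]; apply/eqP.
  have := coef_diffp g a i; rewrite i_n /= => <-.
  by rewrite eD nth_default // (leq_trans sXH).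
apply/eqP; rewrite -subr_eq0; apply: contraT => nz.
have : Xn1dvd n (diffp g a - 'X^(d - g) * H).
  apply: (@Xn1dvd_Xcancel _ n g) => //.
  have -> : 'X^g * (diffp g a - 'X^(d - g) * H) =
     wordp a * ('X^g - 1) - 'X^d * H - (wordp a * ('X^g - 1) - 'X^g * diffp g a).
    rewrite -(subnKC gd) exprD addKn; ring.
  by apply: Xn1dvdB hH (wordp_diff _ _).
move=> /(size_Xn1dvd n_gt0) /(_ nz); rewrite ltnNge => /negP[].
apply: leq_trans (size_polyD _ _) _; rewrite size_polyN geq_max.
by rewrite size_diffp_le (leq_trans sXH).
Qed.

(** Reading both runs from the base point a makes them differences of one S; the H of the unwrapped
    case then feeds [diffp_run] at either mismatch. *)
Lemma two_runs d e a b (P := diffp d a) (Q := diffp e b) (g := gcdn d e) :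
  (0 < d)%N -> (0 < e)%N -> f a != f (a + d)%N -> f b != f (b + e)%N ->
  (size P + e <= n)%N -> (size Q + d <= n)%N ->
  [/\ (a + d = b + e %[mod n])%N, (size Q + d = size P + e)%N,
      forall i, (size P <= i < n)%N -> f (a + i)%N = f (a + i + g)%N &
      forall i, (size Q <= i < n)%N -> f (b + i)%N = f (b + i + g)%N] \/
  exists r (A B : {poly int}),
    [/\ (0 < r < n)%N /\ (A`_0 != 0 /\ B`_0 != 0),
        P * ('X^e - 1) = A + 'X^r * B, Q * ('X^d - 1) = B + 'X^(n - r) * A,
        (size P + e = r + size B)%N /\ (size Q + d = n - r + size A)%N &
        Xn1dvd g A /\ Xn1dvd g B].
Proof.
rewrite -!coef0_diffp => d0 e0 P0 Q0 sP sQ.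
(* [a * n] is a whole number of turns, added so that the subtraction does not truncate. *)
pose k := (b + a * n - a)%N.
have le_a : (a <= a * n)%N by rewrite leq_pmulr.
have ak : (a + k = b + a * n)%N by rewrite /k; lia.
have hb : Xn1dvd n ('X^k * wordp b - wordp a).
  by rewrite -(wordp_perM b a) -ak; apply: wordp_shift.
have hQ : Xn1dvd n (wordp a * ('X^e - 1) - 'X^(k + e) * Q).
  have -> : wordp a * ('X^e - 1) - 'X^(k + e) * Q =
      'X^k * (wordp b * ('X^e - 1) - 'X^e * Q)
      - ('X^e - 1) * ('X^k * wordp b - wordp a) by rewrite exprD; ring.
  by apply: Xn1dvdB; apply: Xn1dvdM => //; apply: wordp_diff.
have [] := two_differences n_gt0 d0 e0 P0 Q0 sP sQ (wordp_diff d a) hQ;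
  last by right.
move=> [dke [H [hP1 hQ1 hS]]]; left.
have [Pn0 Qn0] := (coef0_neq0 P0, coef0_neq0 Q0).
have g0 : (0 < g)%N by rewrite gcdn_gt0 d0.
have Hn0 : H != 0.
  apply: contraNneq Pn0 => H0; move: hP1; rewrite H0 mul0r => /eqP.
  rewrite mulf_eq0 => /orP[//|/eqP h].
  by have := size_Xn_sub_1 int g0; rewrite h size_poly0.
have sHP : (size P + g = size H + d)%N.
  by rewrite -!(size_mulXn1 (R := int)) ?hP1.
have sHQ : (size Q + g = size H + e)%N.
  by rewrite -!(size_mulXn1 (R := int)) ?hQ1.
have gd : (g <= d)%N by apply: dvdn_leq (dvdn_gcdl _ _).
have ge : (g <= e)%N by apply: dvdn_leq (dvdn_gcdr _ _).
split.
- by rewrite -modnDmr dke modnDmr addnA ak addnAC addnC modnMDl.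
- lia.
- by apply: (diffp_run _ gd _ hS); rewrite ?sHP // (leq_trans _ sP) ?leq_addr.
- have hS' : Xn1dvd n (wordp b * ('X^g - 1) - 'X^e * H).
    apply: (@Xn1dvd_Xcancel _ n k) => //.
    have -> : 'X^k * (wordp b * ('X^g - 1) - 'X^e * H) =
      ('X^g - 1) * ('X^k * wordp b - wordp a)
      + (wordp a * ('X^g - 1) - 'X^d * H) + H * ('X^d - 'X^(k + e)).
      rewrite exprD; ring.
    by do 2?apply: Xn1dvdD => //; apply: Xn1dvdM => //; apply: Xn1dvd_Xmod.
  by apply: (diffp_run _ ge _ hS'); rewrite ?sHQ // (leq_trans _ sQ) ?leq_addr.
Qed.

End CyclicWords.

(** * Wrapped configurations of two repeats *)

Section Wrapping.
Implicit Types (n w d e g r : nat).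

(* Counting coefficients excludes wrapping when 4 w <= n + 2, for w = n - c; the
   other cases are those between this bound and c0. *)
Definition no_wrap_cond n w d e : Prop :=
  [\/ 4 * w <= n + 2,
      exists m, 2 < m /\
        [\/ n = 4 * m + 1 /\ w = m.+1, n = 4 * m /\ w = m.+1 /\ 3 < m
          | n = 8 * m + 4 /\ w = 2 * m + 3] |
      [/\ n = 20, w = 7 & (d < 6) || (e < 6)]].

Lemma no_wrap_condC n w d e : no_wrap_cond n w d e -> no_wrap_cond n w e d.
Proof.
case=> [h|h|[n20 w7 h]]; [exact: Or31 | exact: Or32 | apply: Or33].
by split; rewrite // orbC.
Qed.

(** Keeps some divisibility once the gcd is generalized for [lia]: two even spacings force A and B,
    nonzero multiples of X^gcd(d,e) - 1, to size at least 3. *)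
Lemma gcdn_parity d e : 0 < d -> [|| odd d, odd e | 1 < gcdn d e].
Proof.
move=> d0; have [//|ed] := boolP (odd d); have [//|ee] := boolP (odd e).
by apply: (@dvdn_leq 2); rewrite ?gcdn_gt0 ?d0 // dvdn_gcd !dvdn2 ed ee.
Qed.

(** The last two hypotheses are the outcomes of [short_cyclic_shift] modulo X^e - 1 and X^d - 1.
    Adding the size equations gives n + 2 gcd(d,e) + 2 <= 2w + 2 + d + e, which contradicts 4w <= n
    + 2; in the other cases it makes A and B so short that e divides r and d divides n - r, with
    small quotients. *)
Lemma no_wrap n w d e r sP sQ sA sB :
  no_wrap_cond n w d e -> 0 < d -> d < e -> e <= w -> 0 < r < n ->
  sP <= w.+1 -> sQ <= w.+1 -> sP + e = r + sB -> sQ + d = n - r + sA ->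
  gcdn d e < sA -> gcdn d e < sB ->
  (sA + sB <= e.+1 -> e %| r /\ sA = sB) ->
  (sA + sB <= d.+1 -> d %| n - r) -> False.
Proof.
move=> cond d0 de ew /andP[r0 rn] sPw sQw eP eQ gA gB he hd.
have [t [t0 nE ntE]] : exists t, [/\ 0 < t, n = r + t & n - r = t].
  by exists (n - r); rewrite subn_gt0 rn subnKC // ltnW.
rewrite {}ntE in eQ hd.
have gde : gcdn d e + d <= e.
  rewrite addnC -leq_subRL ?(ltnW de) // dvdn_leq ?subn_gt0 //.
  by rewrite dvdn_sub ?dvdn_gcdl ?dvdn_gcdr.
have g0 : 0 < gcdn d e by rewrite gcdn_gt0 d0.
have gpar := @gcdn_parity d e d0.
move: (gcdn d e) gA gB gde g0 gpar => g gA gB gde g0 gpar.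
have tot : sP + sQ + e + d = n + sA + sB by clear he hd gpar; lia.
have tot_le : n + sA + sB <= 2 * w + 2 + e + d by clear he hd gpar; lia.
have tot_g : n + 2 * g + 2 <= 2 * w + 2 + e + d by clear he hd gpar; lia.
case: cond => [cond|[m [m2 cond]]|[n20 w7 d6]];
  [by clear he hd gpar; lia | | ]; last first.
  have [|er eAB] := he.
    by clear -tot_le de d6 n20 w7; lia.
  case/dvdnP: er => i er; subst sB.
  have i2 : i <= 2.
    rewrite leqNgt; apply/negP => i2.
    have : 3 * e <= r by rewrite er leq_mul2r i2 orbT.
    by clear gpar he hd er; lia.
  have r2 : r = 2 * e.
    by move: er i2; case: i => [|[|[|//]]] er _; clear gpar he hd; lia.
  have short : sA + sA <= d.+1 by clear he hd er; lia.
  have /dvdnP[j dr] := hd short; clear he hd er short.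
  by case: d d0 de d6 dr eQ tot tot_le tot_g gde gpar => [|[|[|[|[|[|d]]]]]] *; lia.
have short : sA + sB <= d.+1.
  by clear - tot_le cond ew m2; case: cond => -[? ?]; lia.
have [er eAB] := he (leq_trans short (leqW de)).
have {hd he short} dr := hd short.
case/dvdnP: er => i er; case/dvdnP: dr => j dr; subst sB.
have i3 : i <= 2.
  rewrite leqNgt; apply/negP => i3.
  have : 3 * e <= r by rewrite er leq_mul2r i3 orbT.
  by clear gpar er dr; case: cond => -[? ?]; lia.
have j4 : j <= 4.
  rewrite leqNgt; apply/negP => j5.
  have : 5 * d <= t by rewrite dr leq_mul2r j5 orbT.
  by clear gpar er dr; case: cond => -[? ?]; lia.
have [cond'|[n8 w2]] : ((n = 4 * m + 1 \/ n = 4 * m /\ 3 < m) /\ w = m.+1) \/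
    (n = 8 * m + 4 /\ w = 2 * m + 3).
  by case: cond => -[? ?]; [left|left|right]; tauto.
  clear gpar.
  case: i er i3 => [|[|[|//]]] er _; case: j dr j4 => [|[|[|[|[|//]]]]] dr _;
  lia.
(* Parity matters here: d = 2m, e = 2m + 2, i = j = 2 meets every size equation unless the gcd is
   known to be at least 2. *)
clear cond.
case: i er i3 => [|[|[|//]]] er _; case: j dr j4 => [|[|[|[|[|//]]]]] dr _; lia.
Qed.

End Wrapping.

(** * Comparing two runs on the circle *)

Section CyclicRuns.
Variables (n : nat) (f : nat -> bool).
Hypotheses (n_gt0 : 0 < n) (f_per : forall j, f (j + n) = f j).
Implicit Types (w a b d e g i : nat).

Lemma size_diffp_leP d a m : (size (diffp n f d a) <= m) <->
  (forall i, m <= i < n -> f (a + i) = f (a + i + d)).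
Proof.
split=> [sD i /andP[mi i_n] | hD].
  apply/eqP; move: (coef_diffp n f d a i); rewrite i_n /= => <-.
  by rewrite nth_default // (leq_trans sD).
apply/leq_sizeP => i mi; apply/eqP; rewrite coef_diffp.
by apply/implyP => i_n; rewrite hD // mi.
Qed.

Lemma size_diffp_gt0 d a : f a != f (a + d) -> 0 < size (diffp n f d a).
Proof. by rewrite -(coef0_diffp f n_gt0) => /coef0_neq0; rewrite size_poly_gt0. Qed.

(** For a = c - 1 and w = n - c these indices cover, one turn later, the run at positions 0, ..., c
    - 2 that membership in B(n,c,d) guarantees. *)
Definition primitive_run w d a :=
  forall g, 0 < g < d -> g %| d ->
  exists2 i, w < i < n & f (a + i) != f (a + i + g).

(** A wrap needs sizes adding up to at least n + 2, so 2w <= n only allows it when both sizes equal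
    w + 1. *)
Lemma same_spacing_size w d a b : 0 < d -> 2 * w <= n ->
  f a != f (a + d) -> f b != f (b + d) ->
  size (diffp n f d a) <= w.+1 -> size (diffp n f d b) <= w.+1 ->
  size (diffp n f d a) = size (diffp n f d b).
Proof.
move=> d0 wn fa fb sP sQ.
pose k := b + a * n - a.
have le_a : a <= a * n by rewrite leq_pmulr.
have ak : a + k = b + a * n by rewrite /k; lia.
have hb : Xn1dvd n ('X^k * wordp n f b - wordp n f a)%R.
  by rewrite -(wordp_perM f_per b a) -ak; apply: wordp_shift.
have hab : Xn1dvd n (diffp n f d a - 'X^(k %% n) * diffp n f d b)%R.
  apply: (@Xn1dvd_Xcancel _ n d) => //.
  have -> : ('X^d * (diffp n f d a - 'X^(k %% n) * diffp n f d b) =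
    - (wordp n f a * ('X^d - 1) - 'X^d * diffp n f d a)
    + 'X^k * (wordp n f b * ('X^d - 1) - 'X^d * diffp n f d b)
    - ('X^d - 1) * ('X^k * wordp n f b - wordp n f a)
    + ('X^d * diffp n f d b) * ('X^k - 'X^(k %% n)))%R by ring.
  apply: Xn1dvdD; last by apply/Xn1dvdM/Xn1dvd_Xmod; rewrite modn_mod.
  apply: Xn1dvdB; last exact: Xn1dvdM.
  apply: Xn1dvdD; first exact/Xn1dvdN/wordp_diff.
  exact/Xn1dvdM/wordp_diff.
move: fa fb; rewrite -!(coef0_diffp f n_gt0) => P0 Q0.
have kn : k %% n < n by rewrite ltn_mod.
have [||[_ ->//]|] := cyclic_shift_cases kn _ _ P0 Q0 hab;
  try exact: size_diffp_le.
move=> [A [B [_ [/coef0_neq0 A0 /coef0_neq0 B0] _ _ [sP' sQ']]]].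
move: A0 B0; rewrite -!size_poly_gt0 => A0 B0.
move: sP sQ; rewrite sP' sQ'; move: (size A) (size B) (k %% n) kn A0 B0.
by clear -wn; move=> x y z; lia.
Qed.

(** If d < e, the unwrapped case makes gcd(d,e) <= d a period of the primitive run of spacing e.
    Exchanging the runs gives d = e. *)
Lemma spacing_le w d e a b :
  no_wrap_cond n w d e -> 0 < d <= w -> 0 < e <= w ->
  f a != f (a + d) -> f b != f (b + e) ->
  size (diffp n f d a) <= w.+1 -> size (diffp n f e b) <= w.+1 ->
  primitive_run w e b -> e <= d.
Proof.
move=> cond /andP[d0 dw] /andP[e0 ew] fa fb sP sQ prim.
rewrite leqNgt; apply/negP => de.
have wn : w.*2 < n.
  case: cond => [h|[m [m2 h]]|[-> -> _]] //; first by lia.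
  by clear -h m2; case: h => -[? ?]; lia.
have sPn : size (diffp n f d a) + e <= n by move: sP; lia.
have sQn : size (diffp n f e b) + d <= n by move: sQ; lia.
have [] := two_runs n_gt0 f_per d0 e0 fa fb sPn sQn.
  move=> [_ _ _ hQ]; have g0 : 0 < gcdn d e by rewrite gcdn_gt0 d0.
  have gd : gcdn d e <= d by apply: dvdn_leq (dvdn_gcdl _ _).
  case: (prim (gcdn d e)); rewrite ?g0 ?(leq_ltn_trans gd) ?dvdn_gcdr //.
  move=> i /andP[wi i_n] /eqP[]; apply: hQ.
  by rewrite i_n (leq_trans sQ).
move=> [r [A [B [[rn [A0 B0]] eF eG [szF szG] [gA gB]]]]].
have g0 : 0 < gcdn d e by rewrite gcdn_gt0 d0.
apply: (no_wrap cond d0 de ew rn sP sQ szF szG).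
- exact: size_Xn1dvd (coef0_neq0 A0).
- exact: size_Xn1dvd (coef0_neq0 B0).
- move=> sAB; apply: short_cyclic_shift sAB => //.
  by rewrite -eF; exists (diffp n f d a).
- rewrite addnC => sAB; apply: (proj1 (short_cyclic_shift _ _ _ _ sAB)) => //.
  by rewrite -eG; exists (diffp n f e b).
Qed.

(** Serves the upper bound for the periodic sequence: n minus the size of a difference polynomial is
    the length of its run. Since e is bounded by n/2 only, counting settles e <= w, and for w < e
    the coefficients of P (X^e - 1) and A + X^r B are compared. *)
Lemma no_longer_repeat w d e a b :
  4 * w <= n + 3 -> 0 < d <= w -> 0 < e -> 2 * e <= n ->
  f a != f (a + d) -> f b != f (b + e) -> primitive_run w d a ->
  size (diffp n f d a) <= w.+1 ->
  size (diffp n f d a) <= size (diffp n f e b).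
Proof.
move=> wn /andP[d0 dw] e0 en fa fb prim sP.
rewrite leqNgt; apply/negP => sQP.
have [ede|nde] := eqVneq d e.
  subst e; have := sQP; rewrite (@same_spacing_size w d a b) ?ltnn //; first lia.
  exact: leq_trans (ltnW sQP) sP.
have sPn : size (diffp n f d a) + e <= n by clear -sP wn dw d0 e0 en nde; lia.
have sQn : size (diffp n f e b) + d <= n by clear -sP wn dw d0 e0 en nde sQP; lia.
have P_gt0 := size_diffp_gt0 fa; have Q_gt0 := size_diffp_gt0 fb.
have [] := two_runs n_gt0 f_per d0 e0 fa fb sPn sQn.
  move=> [_ sPQ hP _]; have g0 : 0 < gcdn d e by rewrite gcdn_gt0 d0.
  have ge : gcdn d e <= e by apply: dvdn_leq (dvdn_gcdr _ _).
  have ed : e < d by move: sPQ sQP; lia.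
  case: (prim (gcdn d e)); rewrite ?g0 ?(leq_ltn_trans ge) ?dvdn_gcdl //.
  move=> i /andP[wi i_n] /eqP[]; apply: hP.
  by rewrite i_n (leq_trans sP).
set P := diffp n f d a in sP sQP sPn P_gt0 *.
set Q := diffp n f e b in sQP sQn Q_gt0 *.
move=> [r [A [B [[/andP[r0 rn] [A0 B0]] eF eG [szF szG] [gA gB]]]]].
have g0 : 0 < gcdn d e by rewrite gcdn_gt0 d0.
have sA : 1 < size A by apply: leq_ltn_trans (size_Xn1dvd g0 gA (coef0_neq0 A0)).
have sB : 1 < size B by apply: leq_ltn_trans (size_Xn1dvd g0 gB (coef0_neq0 B0)).
have tot : size P + size Q + e + d = n + size A + size B.
  by clear -szF szG rn; move: szF szG; lia.
have [we|we] := leqP e w.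
  have de : d + e < 2 * w by clear -we dw nde; lia.
  by clear -de wn tot sP sQP sA sB; lia.
(* P and X^e P do not overlap, and the gap between them is the only one wide
   enough to be the gap between A and X^r B. *)
have gap : size P + size A <= r.+1.
  by clear -we wn szG sP sQP dw sA rn en; move: szG; lia.
have [le_Pr le_Ar] : size P <= r /\ size A <= r.
  by move: gap sA P_gt0; move: (size A) (size P); clear; lia.
have coefF i : ((A + 'X^r * B)`_i = (if (i < e)%N then 0 else P`_(i - e)) - P`_i)%R.
  by rewrite -eF mulrBr mulr1 coefB mulrC coefXnM.
have coefA i : i < r -> ((A + 'X^r * B)`_i = A`_i)%R.
  by move=> ir; rewrite coefD coefXnM ir addr0.
(* If r < e, the coefficient of X^r would be B_0 on one side and 0 on the other; if e < r, that of
   X^e would be P_0, making A longer than [gap] allows. *)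
have er : r = e.
  case: (ltngtP r e) => // h.
    have : (P`_r = 0)%R by rewrite nth_default.
    have := coefF r; rewrite h coefD coefXnM ltnn subnn.
    rewrite (_ : A`_r = 0)%R; last by rewrite nth_default.
    by move=> + Pr; rewrite Pr subrr add0r => B0'; rewrite B0' eqxx in B0.
  have := coefF e; rewrite coefA // ltnn subnn.
  rewrite (_ : P`_e = 0)%R; last by rewrite nth_default // (leq_trans sP).
  rewrite subr0 => Ae.
  have P0 : (P`_0 != 0)%R by rewrite (coef0_diffp f n_gt0).
  have eA : e < size A.
    by rewrite ltnNge; apply/negP => /(nth_default 0%R) A'; rewrite -Ae A' eqxx in P0.
  by clear -gap eA szF sB; move: szF gap; lia.
(* Below r = e, A agrees with -P, so it reaches at least the leading coefficient of P. *)
have sAP : size P <= size A.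
  rewrite -[size P](prednK P_gt0) ltnNge; apply/negP => /(nth_default 0%R).
  have lt_e : (size P).-1 < e by clear -we sP P_gt0; lia.
  rewrite -coefA; last by rewrite er.
  rewrite coefF lt_e sub0r => /eqP; rewrite oppr_eq0.
  by rewrite -lead_coefE lead_coef_eq0 -size_poly_eq0 => /eqP P0; rewrite P0 in P_gt0.
by clear -szG er sAP sQP en we dw; move: szG; rewrite er; lia.
Qed.

(* A repeat of length c inside s_0 ... s_(n-1) has spacing e < n - c, which leaves
   no room for the wrapped configuration. *)
Lemma no_finite_repeat c d e i :
  4 * (n - c) <= n + 3 -> c <= n -> 0 < d <= n - c -> 0 < e -> 0 < c ->
  i + c + e < n ->
  f c.-1 != f (c.-1 + d) -> primitive_run (n - c) d c.-1 ->
  size (diffp n f d c.-1) <= (n - c).+1 ->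
  (forall j, j < c -> f (i + j) = f (i + j + e)) ->
  f (i + c) = f (i + c + e).
Proof.
move=> wn cn /andP[d0 dw] e0 c0 icn fa prim sP run.
apply/eqP; apply: contraT => fb.
have sQ : size (diffp n f e (i + c)) <= n - c.
  apply/size_diffp_leP => j /andP[j1 j2].
  have -> : i + c + j = i + (c + j - n) + n by lia.
  by rewrite f_per addnAC f_per run //; lia.
have [ede|nde] := eqVneq d e.
  case/negP: fa; apply/eqP; rewrite ede.
  by have := run (c.-1 - i); rewrite subnKC; [apply; lia | lia].
have sPn : size (diffp n f d c.-1) + e <= n by clear -sP wn dw d0 e0 icn nde; lia.
have sQn : size (diffp n f e (i + c)) + d <= n by clear -sQ wn dw d0 e0 icn nde; lia.
have [] := two_runs n_gt0 f_per d0 e0 fa fb sPn sQn.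
  move=> [pos _ hP _]; have g0 : 0 < gcdn d e by rewrite gcdn_gt0 d0.
  have ge : gcdn d e <= e by apply: dvdn_leq (dvdn_gcdr _ _).
  have ed : e < d by move: pos; rewrite !modn_small; lia.
  case: (prim (gcdn d e)); rewrite ?g0 ?(leq_ltn_trans ge) ?dvdn_gcdl //.
  move=> j /andP[wj j_n] /eqP[]; apply: hP.
  by rewrite j_n (leq_trans sP).
move=> [r [A [B [[/andP[r0 rn] [A0 B0]] eF eG [szF szG] [gA gB]]]]].
have g0 : 0 < gcdn d e by rewrite gcdn_gt0 d0.
have sA : 1 < size A by apply: leq_ltn_trans (size_Xn1dvd g0 gA (coef0_neq0 A0)).
have sB : 1 < size B by apply: leq_ltn_trans (size_Xn1dvd g0 gB (coef0_neq0 B0)).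
have tot : size (diffp n f d c.-1) + size (diffp n f e (i + c)) + e + d
    = n + size A + size B by clear -szF szG rn; move: szF szG; lia.
by clear -wn tot sP sQ dw sA sB icn; lia.
Qed.

End CyclicRuns.

(** * From words to repeats *)

Section PeriodicWords.
Implicit Types (n c d e j k : nat) (s u : seq bool).

Lemma nth_flatten_nseq q u j : j < q * size u ->
  nth false (flatten (nseq q u)) j = nth false u (j %% size u).
Proof.
elim: q j => [//|q IH] j; rewrite mulSn /= nth_cat => jq.
case: ltnP => ju; first by rewrite modn_small.
rewrite IH ?ltn_subLR //; by rewrite -[in RHS](subnK ju) modnDr.
Qed.

Lemma size_flatten_nseq q u : size (flatten (nseq q u)) = q * size u.
Proof. by rewrite size_flatten /shape map_nseq sumn_nseq mulnC. Qed.

Lemma step_modn (g : nat -> bool) e m :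
  (forall j, j + e < m -> g j = g (j + e)) -> forall j, j < m -> g j = g (j %% e).
Proof.
move=> h; case: (posnP e) => [->|e0] j; first by rewrite modn0.
elim/ltn_ind: j => j IH jm; case: (ltnP j e) => je; first by rewrite modn_small.
rewrite -{1}(subnK je) -h ?subnK // IH; [|lia|lia].
by rewrite -[in RHS](subnK je) modnDr.
Qed.

Lemma periodicP s : reflect
  (exists e, [/\ 0 < e < size s, e %| size s &
     forall j, j + e < size s -> nth false s j = nth false s (j + e)])
  (periodic s).
Proof.
apply: (iffP hasP) => [[e]|[e [e1 e2 e3]]].
  rewrite mem_iota => e1 /andP[e2 /eqP e3].
  have sz : size (take e s) = e by rewrite size_takel; lia.
  have h j : j < size s -> nth false s j = nth false s (j %% e).
    move=> js; rewrite e3 nth_flatten_nseq sz ?divnK //.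
    rewrite -e3 nth_take // ltn_mod; lia.
  exists e; split=> // [|j je]; first lia.
  by rewrite (h j) ?(h (j + e)) ?modnDr //; lia.
exists e; first by rewrite mem_iota; lia.
rewrite e2 /=; apply/eqP.
have sz : size (take e s) = e by rewrite size_takel; lia.
apply: (@eq_from_nth _ false) => [|j js].
  by rewrite size_flatten_nseq sz divnK.
rewrite nth_flatten_nseq sz ?divnK // nth_take; last by rewrite ltn_mod; lia.
exact: (step_modn e3).
Qed.

Lemma periodic_half s : periodic s ->
  exists e, [/\ 0 < e, 2 * e <= size s &
     forall j, j + e < size s -> nth false s j = nth false s (j + e)].
Proof.
case/periodicP=> e [/andP[e0 es] /dvdnP[k hk] e3]; exists e; split=> //.
by case: k hk => [|[|k]] hk; rewrite ?mulSn in hk; lia.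
Qed.

Lemma per_ext_per s j : per_ext s (j + size s) = per_ext s j.
Proof. by rewrite /per_ext modnDr. Qed.

Lemma per_ext_small s j : j < size s -> per_ext s j = nth false s j.
Proof. by move=> js; rewrite /per_ext modn_small. Qed.

Lemma per_ext_rotr k s j : k <= size s ->
  per_ext (rotr k s) j = per_ext s (j + (size s - k)).
Proof.
move=> ks; case: (posnP (size s)) => [/size0nil -> |s0].
  by rewrite /per_ext !nth_default // size_rotr.
rewrite /per_ext size_rotr -modnDml.
have : j %% size s < size s by rewrite ltn_mod.
move: (j %% size s) => i i_s.
rewrite /rotr /rot nth_cat size_drop; case: ltnP => h.
  by rewrite nth_drop addnC modn_small //; lia.
rewrite nth_take; last by lia.
congr nth; rewrite -[in RHS](subnK h).
have -> : i - (size s - (size s - k)) + (size s - (size s - k)) + (size s - k)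
   = i - (size s - (size s - k)) + size s by lia.
by rewrite modnDr modn_small //; lia.
Qed.

Lemma periodic_per_ext s : periodic s <->
  exists e, [/\ 0 < e < size s, e %| size s &
     forall j, per_ext s j = per_ext s (j + e)].
Proof.
split.
  case/periodicP=> e [e1 e2 /step_modn e3]; exists e; split=> // j.
  have s0 : 0 < size s by lia.
  rewrite /per_ext (e3 (j %% _)) ?ltn_mod // (e3 ((j + e) %% _)) ?ltn_mod //.
  by rewrite !modn_dvdm // modnDr.
case=> e [e1 e2 e3]; apply/periodicP; exists e; split=> // j je.
by have := e3 j; rewrite !per_ext_small //; lia.
Qed.

Lemma periodic_rotr k s : k <= size s -> periodic (rotr k s) -> periodic s.
Proof.
move=> ks /periodic_per_ext[e [e1 e2 e3]]; apply/periodic_per_ext.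
rewrite size_rotr in e1 e2; exists e; split=> // j.
have := e3 (j + k); rewrite !per_ext_rotr // [j + k + e]addnAC.
by rewrite -!addnA subnKC // addnA !per_ext_per.
Qed.

(** The q copies and the partial copy have total length c + d - 1 and period d; the complemented
    letter breaks this period at distance d from position c - 1. *)
Lemma inBP n c d s : 0 < c -> reflect
  [/\ size s = n, [/\ 0 < d, d <= n - c & d <= n./2],
      aperiodic s, aperiodic (take d s) &
      (forall j, j.+1 < c -> nth false s j = nth false s (j + d)) /\
      nth false s c.-1 != nth false s (c.-1 + d)]
  (inB n c d s).
Proof.
move=> c0; rewrite /inB.
set q := (c + d).-1 %/ d; set r := (c + d).-1 - q * d.
suff h : size s = n -> 0 < d -> d <= n - c ->
  (take (c + d) s == flatten (nseq q (take d s)) ++ rcons (take r s) (~~ nth false s r))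
  <-> ((forall j, j.+1 < c -> nth false s j = nth false s (j + d)) /\
       nth false s c.-1 != nth false s (c.-1 + d)).
  apply: (iffP and5P).
    case=> /eqP sz d0; rewrite leq_min => /andP[d1 d2] ap /andP[ap' e].
    by split=> //; apply/h.
  case=> sz [d0 d1 d2] ap ap' e; split=> //; rewrite ?sz ?leq_min ?d1 //.
  by rewrite ap' /=; apply/h.
move=> sz d0 dn.
have rE : r = (c + d).-1 %% d by rewrite /r /q {1}(divn_eq (c + d).-1 d) addKn.
have qr : (c + d).-1 = q * d + r by rewrite rE -divn_eq.
have rd : r < d by rewrite rE ltn_mod.
have sd : size (take d s) = d by rewrite size_takel; lia.
have sr : size (take r s) = r by rewrite size_takel; lia.
pose v := flatten (nseq q (take d s)) ++ rcons (take r s) (~~ nth false s r).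
have sv : size v = c + d.
  by rewrite size_cat size_flatten_nseq size_rcons sd sr addnS -qr; lia.
have nv j : j < (c + d).-1 -> nth false v j = nth false s (j %% d).
  move=> jm; rewrite /v nth_cat size_flatten_nseq sd; case: ltnP => jq.
    by rewrite nth_flatten_nseq sd // nth_take // ltn_mod.
  rewrite nth_rcons sr; have -> : j - q * d < r by lia.
  rewrite nth_take; last by lia.
  by rewrite -[in RHS](subnK jq) addnC modnMDl modn_small //; lia.
have nvm : nth false v (c + d).-1 = ~~ nth false s r.
  rewrite /v nth_cat size_flatten_nseq sd qr ltnNge leq_addr /= addKn.
  by rewrite nth_rcons sr ltnn eqxx.
(* So complementing s_r amounts to complementing s_(c-1). *)
have cr : c.-1 %% d = r.
  by rewrite rE; have -> : (c + d).-1 = c.-1 + d; [lia | rewrite modnDr].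
have cd1 : c.-1 + d = (c + d).-1 by lia.
split.
  move/eqP => e.
  have nE j : j < c + d -> nth false s j = nth false v j.
    by move=> jm; rewrite -(nth_take _ jm) e.
  split.
    move=> j jc; rewrite (nE j) ?(nE (j + d)) ?nv ?modnDr //; lia.
  rewrite (nE c.-1) ?(nE (c.-1 + d)); try lia.
  by rewrite cd1 nvm nv ?cr; [case: (nth _ _ _) | lia].
case=> e1 e2; apply/eqP; rewrite -/v; apply: (@eq_from_nth _ false) => [|j].
  by rewrite size_takel ?sv //; lia.
rewrite size_takel; last by lia.
have e3 : forall j, j < (c + d).-1 -> nth false s j = nth false s (j %% d).
  by apply: step_modn => i id; apply: e1; lia.
move=> jm; rewrite nth_take //; case: (ltnP j (c + d).-1) => jm'.
  by rewrite nv // -e3.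
have -> : j = (c + d).-1 by lia.
rewrite nvm -cr -e3; last by lia.
by move: e2; rewrite cd1; case: (nth _ _ _); case: (nth _ _ _).
Qed.

Lemma inBc_spacing n c s : inBc n c s ->
  [/\ n./2 <= c, 0 < c & inB n c (spacing n c s) s].
Proof.
case/andP=> nc /hasP[d]; rewrite mem_iota => /andP[d1].
rewrite add1n ltnS leq_min => /andP[d2 d3] hd.
split=> //; first by lia.
have : d \in [seq d <- iota 1 n | inB n c d s].
  by rewrite mem_filter hd mem_iota; lia.
rewrite /spacing; case E : [seq _ <- _ | _] => [//|d' l] _ /=.
have : d' \in [seq d <- iota 1 n | inB n c d s] by rewrite E mem_head.
by rewrite mem_filter => /andP[].
Qed.

End PeriodicWords.

(** * Additional run length and representatives *)

Section Representatives.
Implicit Types (n c d e j k : nat) (s : seq bool).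

Lemma per_ext_run n c d s : 0 < c -> inB n c d s ->
  [/\ forall j, j.+1 < c -> per_ext s j = per_ext s (j + d) &
      per_ext s c.-1 != per_ext s (c.-1 + d)].
Proof.
move=> c0 /(inBP _ _ _ c0)[sz [d0 d1 d2] _ _ [h1 h2]]; split.
  by move=> j jc; rewrite !per_ext_small ?sz; [apply: h1 | lia | lia].
by rewrite !per_ext_small ?sz; [| lia | lia].
Qed.

(** [add] measures how far the d-run from position 0 extends backwards across the end of the word;
    the size counts what remains of the n - c + 1 positions from c - 1 to n - 1. *)
Lemma add_size n c d s : 0 < c -> inB n c d s ->
  add_d d s + size (diffp n (per_ext s) d c.-1) = (n - c).+1.
Proof.
move=> c0 hB; have [run mis] := per_ext_run c0 hB.
have [sz [d0 d1 d2] _ _ _] := inBP _ _ _ c0 hB.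
set f := per_ext s in run mis *.
have f_per j : f (j + n) = f j by rewrite -sz; apply: per_ext_per.
pose p t := nth false s (n.-1 - t) != nth false s (d.-1 - t %% d).
(* While all earlier comparisons succeed, the prefix letter (d - 1 - t) mod d is the letter at
   cyclic distance d: for t >= d it equals the one at n - 1 - (t - d). *)
have fE t : t < n -> (forall i, i < t -> ~~ p i) ->
    p t = (f (n.-1 - t) != f (n.-1 - t + d)).
  move=> tn IH; rewrite /p -per_ext_small ?sz; last by lia.
  congr (_ != _); case: (ltnP t d) => td.
    have -> : n.-1 - t + d = d.-1 - t + n by lia.
    by rewrite f_per modn_small // /f per_ext_small //; lia.
  have -> : n.-1 - t + d = n.-1 - (t - d) by lia.
  have /IH : t - d < t by lia.
  rewrite /p negbK /f per_ext_small ?sz; last by lia.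
  by move=> /eqP ->; rewrite -{1}(subnK td) modnDr.
have wn : n.-1 - (n - c) = c.-1 by lia.
pose t := add_d d s.
have tE : t = find p (iota 0 n) by rewrite /t /add_d sz.
have before i : i < t -> i < n -> ~~ p i.
  move=> it i_n; have := before_find 0 (_ : i < find p (iota 0 n)).
  by rewrite -tE nth_iota // add0n => /(_ it) ->.
(* At t = n - c the position compared is c - 1, the mismatch. *)
have tw : t <= n - c.
  rewrite leqNgt; apply/negP => wt.
  have wn' : n - c < n by lia.
  have := before _ wt wn'; rewrite fE //.
    by rewrite wn mis.
  by move=> i iw; apply: before; lia.
have pt : p t.
  have : has p (iota 0 n) by rewrite has_find size_iota -tE; lia.
  by move/(nth_find 0); rewrite -tE nth_iota ?add0n //; lia.
have posE i : i <= n - c -> c.-1 + (n - c - i) = n.-1 - i by lia.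
suff -> : size (diffp n f d c.-1) = (n - c - t).+1 by rewrite -/t; lia.
apply/eqP; rewrite eqn_leq; apply/andP; split.
  apply/size_diffp_leP => i /andP[i1 i2].
  case: (leqP i (n - c)) => iw.
    have -> : c.-1 + i = n.-1 - (n - c - i) by lia.
    apply/eqP; rewrite -[_ == _]negbK -fE; try lia.
      by apply: before; lia.
    by move=> j ji; apply: before; lia.
  have -> : c.-1 + i = i - (n - c).+1 + n by lia.
  by rewrite f_per addnAC f_per run //; lia.
rewrite ltnNge; apply/negP => /size_diffp_leP/(_ (n - c - t)).
rewrite posE // => h; move: pt; rewrite fE.
- by rewrite h ?eqxx //; lia.
- by lia.
- by move=> i it; apply: before; lia.
Qed.

Lemma size_diffp_inB n c d s : 0 < c -> inB n c d s ->
  size (diffp n (per_ext s) d c.-1) <= (n - c).+1.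
Proof. by move=> c0 hB; rewrite -(add_size c0 hB) leq_addl. Qed.

(** A period g of the run dividing d would be a period of s_d; the failing index j lies in the run
    because j + 1 < d <= n/2 <= c. *)
Lemma inB_primitive n c d s : n./2 <= c -> 0 < c -> inB n c d s ->
  primitive_run n (per_ext s) (n - c) d c.-1.
Proof.
move=> nc c0 hB g /andP[g0 gd] gdvd.
have [sz [d0 d1 d2] _ ap _] := inBP _ _ _ c0 hB.
have sd : size (take d s) = d by rewrite size_takel; lia.
have [j jd nj] : exists2 j, j + g < d & nth false s j != nth false s (j + g).
  case: (boolP (has (fun j => nth false s j != nth false s (j + g)) (iota 0 (d - g)))).
    by case/hasP=> j; rewrite mem_iota => hj; exists j => //; lia.
  move/hasPn => h; case/negP: ap; apply/periodicP; exists g; rewrite sd.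
  split=> //; first by rewrite g0.
  move=> j jg; rewrite !nth_take; try lia.
  by apply/eqP; rewrite -[_ == _]negbK; apply: h; rewrite mem_iota; lia.
exists (n - c + j.+1); first by lia.
have -> : c.-1 + (n - c + j.+1) = j + size s by lia.
by rewrite per_ext_per addnAC per_ext_per !per_ext_small //; lia.
Qed.

Lemma wordp_rotr n s k a : size s = n -> k <= n ->
  wordp n (per_ext (rotr k s)) a = wordp n (per_ext s) (a + (n - k)).
Proof.
by move=> sz kn; apply: eq_poly => i _; rewrite per_ext_rotr sz // addnAC.
Qed.

Lemma diffp_rotr n s k d a : size s = n -> k <= n ->
  diffp n (per_ext (rotr k s)) d a = diffp n (per_ext s) d (a + (n - k)).
Proof. by move=> sz kn; rewrite /diffp !wordp_rotr // addnAC. Qed.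

Lemma spacing_rotr n c d e k s : no_wrap_cond n (n - c) d e ->
  n./2 <= c -> 0 < c -> k < n -> inB n c d s -> inB n c e (rotr k s) -> d = e.
Proof.
move=> cond nc c0 kn hB hB'.
have [sz [d0 d1 _] _ _ _] := inBP _ _ _ c0 hB.
have [_ [e0 e1 _] _ _ _] := inBP _ _ _ c0 hB'.
have n0 : 0 < n := leq_ltn_trans (leq0n _) kn.
have [_ mis] := per_ext_run c0 hB; have [_ mis'] := per_ext_run c0 hB'.
have sP := size_diffp_inB c0 hB; have sQ := size_diffp_inB c0 hB'.
have prim := inB_primitive nc c0 hB; have prim' := inB_primitive nc c0 hB'.
have f_per j : per_ext s (j + n) = per_ext s j by rewrite -sz per_ext_per.
rewrite (diffp_rotr _ _ sz (ltnW kn)) in sQ.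
rewrite !per_ext_rotr ?sz ?(ltnW kn) // addnAC in mis'.
set b := c.-1 + (n - k) in sQ mis'.
have {}prim' : primitive_run n (per_ext s) (n - c) e b.
  move=> g g1 g2; have [i hi hn] := prim' g g1 g2; exists i => //.
  move: hn; rewrite !per_ext_rotr ?sz ?(ltnW kn) //.
  by rewrite addnAC [c.-1 + i + g + _]addnAC [c.-1 + i + _]addnAC.
have dw : 0 < d <= n - c by rewrite d0.
have ew : 0 < e <= n - c by rewrite e0.
apply/eqP; rewrite eqn_leq.
rewrite (spacing_le n0 f_per (no_wrap_condC cond) ew dw mis' mis sQ sP prim).
by rewrite (spacing_le n0 f_per cond dw ew mis mis' sP sQ prim').
Qed.

Lemma inRc_of_spacing n c s : 2 * (n - c) <= n ->
  (forall d e k, k < n -> inB n c d s -> inB n c e (rotr k s) -> d = e) ->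
  inBc n c s -> inRc n c s.
Proof.
move=> wn same hs; split=> // k kn hk; rewrite /Rshift in hk *.
have [nc c0 hB] := inBc_spacing hs; have [_ _ hB'] := inBc_spacing hk.
rewrite /Defs.add; move: hB hB' (same _ _ _ kn hB hB').
move: (spacing n c s) (spacing n c (rotr k s)) => d e hB hB' ede; subst e.
have [sz [d0 d1 d2] _ _ _] := inBP _ _ _ c0 hB.
have n0 : 0 < n := leq_ltn_trans (leq0n _) kn.
have [_ mis] := per_ext_run c0 hB; have [_ mis'] := per_ext_run c0 hB'.
have sP := size_diffp_inB c0 hB; have sQ := size_diffp_inB c0 hB'.
have add1 := add_size c0 hB; have add2 := add_size c0 hB'.
have f_per j : per_ext s (j + n) = per_ext s j by rewrite -sz per_ext_per.
rewrite (diffp_rotr _ _ sz (ltnW kn)) in add2 sQ.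
rewrite !per_ext_rotr ?sz ?(ltnW kn) // addnAC in mis'.
set b := c.-1 + (n - k) in add2 mis' sQ.
have eq_size := same_spacing_size n0 f_per d0 wn mis mis' sP sQ.
by rewrite -(leq_add2r (size (diffp n (per_ext s) d b))) add2 -eq_size add1.
Qed.

End Representatives.

(** * Nonlinear complexity through repeats *)

Section NonlinearComplexity.
Implicit Types (n c d e i j k L : nat) (s u : seq bool).

Lemma pbE (P : Prop) : pb P -> P.
Proof. by rewrite /pb; case: ClassicalEpsilon.excluded_middle_informative. Qed.

Lemma nlc_unique u L : admits_fin u L ->
  (forall L', L' < L -> ~ admits_fin u L') -> nlc u = L.
Proof.
move=> hL hmin; rewrite /nlc; case: ex_minnP => m /pbE hm /(_ L (pbP hL)) mL.
by apply/eqP; rewrite eqn_leq mL leqNgt; apply/negP => /hmin.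
Qed.

Lemma nlc_per_unique s L : admits_inf (per_ext s) L ->
  (forall L', L' < L -> ~ admits_inf (per_ext s) L') -> nlc_per s = L.
Proof.
move=> hL hmin; rewrite /nlc_per.
case: ex_minnP => m /pbE hm /(_ L (pbP hL)) mL.
by apply/eqP; rewrite eqn_leq mL leqNgt; apply/negP => /hmin.
Qed.

Lemma admits_finP u L :
  (forall i e, 0 < e -> i + L + e < size u ->
     (forall j, j < L -> nth false u (i + j) = nth false u (i + j + e)) ->
     nth false u (i + L) = nth false u (i + L + e)) ->
  admits_fin u L.
Proof.
move=> h; pose w i := take L (drop i u).
exists (fun x => has (fun k => [&& k + L < size u, w k == x & nth false u (k + L)])
  (iota 0 (size u))).
move=> i iu; apply/idP/hasP => [ui|[k _ /and3P[ku /eqP wk uk]]].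
  by exists i; [rewrite mem_iota; lia | rewrite iu eqxx].
have nw a j : j < L -> nth false (w a) j = nth false u (a + j).
  by move=> jL; rewrite nth_take // nth_drop.
have eq_w j : j < L -> nth false u (k + j) = nth false u (i + j).
  by move=> jL; rewrite -!nw // wk.
case: (ltngtP i k) => [ik|ki|->//].
- rewrite (h i (k - i)) ?subn_gt0 //; try lia.
    by have -> : i + L + (k - i) = k + L by lia.
  by move=> j jL; have -> : i + j + (k - i) = k + j; [lia | rewrite eq_w].
- move: uk; rewrite (h k (i - k)) ?subn_gt0 //; try lia.
    by have -> : k + L + (i - k) = i + L by lia.
  by move=> j jL; have -> : k + j + (i - k) = i + j; [lia | rewrite eq_w].
Qed.

Lemma not_admits_fin u L i e : i + L + e < size u ->
  (forall j, j < L -> nth false u (i + j) = nth false u (i + j + e)) ->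
  nth false u (i + L) != nth false u (i + L + e) -> ~ admits_fin u L.
Proof.
move=> iu eq_w; apply: contraNnot => -[f hf]; apply/eqP.
rewrite [i + L + e]addnAC !hf; try lia.
congr f; apply: (@eq_from_nth _ false) => [|j].
  by rewrite !size_takel ?size_drop; lia.
rewrite size_takel ?size_drop; last by lia.
by move=> jL; rewrite !nth_take // !nth_drop eq_w // addnAC.
Qed.

Lemma not_admits_inf (f : nat -> bool) L i e :
  (forall j, j < L -> f (i + j) = f (i + j + e)) ->
  f (i + L) != f (i + L + e) -> ~ admits_inf f L.
Proof.
move=> eq_w; apply: contraNnot => -[h hh]; apply/eqP.
rewrite addnAC !hh; congr h; apply/eq_in_map => j.
by rewrite mem_iota => /andP[_ jL]; rewrite eq_w // addnAC.
Qed.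

(** Equal windows at distance e on the circle are also at distance n - e, so distances up to n/2
    suffice. *)
Lemma admits_infP n (f : nat -> bool) L :
  0 < n -> (forall j, f (j + n) = f j) ->
  (forall i e, 0 < e -> 2 * e <= n ->
     (forall j, j < L -> f (i + j) = f (i + j + e)) -> f (i + L) = f (i + L + e)) ->
  admits_inf f L.
Proof.
move=> n0 f_per h; pose w i := mkseq (fun j => f (i + j)) L.
have f_red i a : f (i %% n + a) = f (i + a).
  by apply: (f_mod f_per); rewrite modnDml.
exists (fun x => has (fun k => (w k == x) && f (k + L)) (iota 0 n)).
move=> i; apply/idP/hasP => [fi|[k _ /andP[/eqP wk fk]]].
  exists (i %% n); first by rewrite mem_iota ltn_mod.
  rewrite f_red fi andbT; apply/eqP/eq_map => j.
  exact: f_red.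
have eq_w j : j < L -> f (k + j) = f (i + j).
  by move=> jL; have := congr1 (nth false ^~ j) wk; rewrite !nth_mkseq.
suff <- : f (k + L) = f (i + L) by [].
clear wk fk; wlog ki : k i eq_w / k <= i => [hw|].
  case: (leqP k i) => [|/ltnW] ki; first exact: hw.
  by apply/esym/hw => // j /eq_w.
have iE : i = k + (i - k) %% n + (i - k) %/ n * n.
  by rewrite -addnA [_ %% n + _]addnC -divn_eq subnKC.
set e := (i - k) %% n in iE; set q := (i - k) %/ n in iE.
have en : e < n by rewrite ltn_mod.
have fi a : f (i + a) = f (k + a + e).
  by rewrite iE addnAC (f_perM f_per) addnAC.
rewrite fi; case: (posnP e) => [->|e0]; first by rewrite addn0.
case: (leqP (2 * e) n) => e2.
  by rewrite -h // => j jL; rewrite -fi eq_w.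
have fk a : f (k + a) = f (i + a + (n - e)).
  rewrite iE; have -> : k + e + q * n + a + (n - e) = k + a + n + q * n by lia.
  by rewrite (f_perM f_per) f_per.
rewrite -fi [RHS](h i (n - e)) -?fk //; try lia.
by move=> j jL; rewrite -fk eq_w.
Qed.

Lemma nlc_inBc n c s : 3 * n %/ 4 <= c -> inBc n c s ->
  nlc_per s = nlc s + Defs.add n c s.
Proof.
move=> c34 hs; have [nc c0 hB] := inBc_spacing hs.
rewrite /Defs.add; set d := spacing n c s in hB *.
have [sz [d0 d1 d2] _ _ _] := inBP _ _ _ c0 hB.
have wn : 4 * (n - c) <= n + 3 by clear -c34; lia.
have [run mis] := per_ext_run c0 hB.
have sP := size_diffp_inB c0 hB; have addE := add_size c0 hB.
have prim := inB_primitive nc c0 hB.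
have n0 : 0 < n by clear -d0 d1; lia.
have cn : c + d <= n by clear -d0 d1; lia.
have f_per j : per_ext s (j + n) = per_ext s j by rewrite -sz per_ext_per.
have -> : nlc s = c.
  apply: nlc_unique => [|L Lc].
    apply: admits_finP => i e e0; rewrite sz => icen eq_w.
    rewrite -!per_ext_small ?sz; [|clear -icen; lia..].
    apply: (no_finite_repeat n0 f_per wn _ _ e0 c0 icen mis prim sP).
    - by clear -cn; lia.
    - by rewrite d0.
    - by move=> j jc; rewrite !per_ext_small ?sz; [apply: eq_w | clear -jc icen; lia..].
  apply: (@not_admits_fin s L (c.-1 - L) d); rewrite ?sz.
  - by clear -Lc cn; lia.
  - move=> j jL; rewrite -!per_ext_small ?sz; [|clear -jL Lc cn; lia..].
    by apply: run; clear -jL Lc; lia.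
  - have -> : c.-1 - L + L = c.-1 by clear -Lc; lia.
    by rewrite -!per_ext_small ?sz //; clear -c0 cn d0; lia.
set t := add_d d s in addE *.
apply: nlc_per_unique => [|L Lc].
  apply: (admits_infP n0 f_per) => i e e0 en eq_w.
  apply/eqP; apply: contraT => mis'.
  have dw : 0 < d <= n - c by rewrite d0.
  have := no_longer_repeat n0 f_per wn dw e0 en mis mis' prim sP.
  (* Equal windows of length c + t before a mismatch push this size below n - c + 1 - t, the size
     for the spacing d. *)
  have : size (diffp n (per_ext s) e (i + (c + t))) <= n - (c + t).
    apply/size_diffp_leP => j /andP[j1 j2].
    have -> : i + (c + t) + j = i + (c + t + j - n) + n by clear -j1; lia.
    by rewrite f_per [_ + n + e]addnAC f_per; apply: eq_w; clear -j1 j2; lia.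
  have : 0 < size (diffp n (per_ext s) d c.-1) by apply: size_diffp_gt0.
  by clear -addE cn; lia.
have Ln : L <= n.
  have : 0 < size (diffp n (per_ext s) d c.-1) by apply: size_diffp_gt0.
  by clear -Lc addE cn; lia.
(* The window ends just before the mismatch c - 1, taken one turn later so that its start does not
   truncate. *)
apply: (@not_admits_inf _ L (c.-1 + n - L) d).
  move=> j jL.
  have -> : c.-1 + n - L + j = c.-1 + (n - L + j) by clear -jL Ln; lia.
  have /size_diffp_leP h := leqnn (size (diffp n (per_ext s) d c.-1)).
  by apply: h; clear -jL Ln Lc addE cn; lia.
have -> : c.-1 + n - L + L = c.-1 + n by clear -Ln; lia.
by rewrite addnAC !f_per.
Qed.

End NonlinearComplexity.

(** * Sharpness *)

Section Sharpness.
Implicit Types (n c d e D j k : nat) (s u : seq bool).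

(** Euclid's algorithm by subtraction: on the prefix shortened by d, e - d is again a period. *)
Lemma fine_wilf (g : nat -> bool) d e L : d + e <= L ->
  (forall j, j + d < L -> g j = g (j + d)) ->
  (forall j, j + e < L -> g j = g (j + e)) ->
  forall j, j + gcdn d e < L -> g j = g (j + gcdn d e).
Proof.
have [m] := ubnP (d + e); elim: m d e L => [//|m IH] d e L.
wlog de : d e / d <= e => [hw|].
  case: (leqP d e) => [|/ltnW] de; first exact: hw.
  rewrite addnC gcdnC => *; exact: (hw e d).
case: (posnP d) => [-> |d0]; first by rewrite gcd0n.
rewrite ltnS => dem deL hd he.
have [ede|nde] := eqVneq d e; first by rewrite -ede gcdnn.
have lt_de : d < e by rewrite ltn_neqAle nde.
set p := gcdn d e.
have pE : p = gcdn d (e - d).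
  by rewrite /p -{1}(subnK de) gcdnDr.
have ped : p <= e - d.
  by rewrite pE; apply: dvdn_leq (dvdn_gcdr _ _); rewrite subn_gt0.
have h1 : forall j, j + p < L - d -> g j = g (j + p).
  rewrite pE; apply: IH; try by clear -dem deL lt_de d0; lia.
    by move=> j jd; apply: hd; clear -jd; lia.
  move=> j je; rewrite (he j); last by clear -je lt_de; lia.
  have -> : j + e = j + (e - d) + d by clear -lt_de; lia.
  by rewrite -hd //; clear -je lt_de; lia.
move=> j jp; case: (ltnP (j + p) (L - d)) => jL; first exact: h1.
have dj : d <= j by clear -jL deL ped lt_de; lia.
rewrite -(subnK dj) -hd; last by clear -jp dj; lia.
rewrite addnAC -hd; last by clear -jp dj; lia.
by apply: h1; clear -jp dj; lia.
Qed.

Lemma inB_spacing_le n c d e s : n - c < c -> inB n c d s -> inB n c e s -> e <= d.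
Proof.
move=> nc hd he; have c0 : 0 < c by clear -nc; lia.
have [sz [d0 d1 d2] _ _ [rd _]] := inBP _ _ _ c0 hd.
have [_ [e0 e1 e2] _ ap [re _]] := inBP _ _ _ c0 he.
rewrite leqNgt; apply/negP => de; case/negP: ap; apply/periodicP.
have sze : size (take e s) = e by rewrite size_takel // sz; clear -e2; lia.
have p0 : 0 < gcdn d e by rewrite gcdn_gt0 d0.
have pd : gcdn d e <= d by apply: dvdn_leq (dvdn_gcdl _ _).
exists (gcdn d e); rewrite sze dvdn_gcdr p0 (leq_ltn_trans pd) //; split=> // j je.
rewrite !nth_take //; last exact: leq_ltn_trans (leq_addr _ _) je.
(* The runs share c + d - 1 letters, at least d + e because e <= n - c < c. *)
apply: (@fine_wilf (nth false s) d e (c.-1 + d)).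
- by clear -e1 nc; lia.
- by move=> i hi; apply: rd; clear -hi; lia.
- by move=> i hi; apply: re; clear -hi de; lia.
- by move: je; move: (gcdn d e) => p; clear -e1 nc; lia.
Qed.

Lemma spacing_eq n c d s : n - c < c -> inB n c d s -> inBc n c s /\ spacing n c s = d.
Proof.
move=> nc hd; have c0 : 0 < c by clear -nc; lia.
have [sz [d0 d1 d2] _ _ _] := inBP _ _ _ c0 hd.
have hs : inBc n c s.
  apply/andP; split; first by clear -nc; lia.
  by apply/hasP; exists d; rewrite // mem_iota; clear -d0 d1 d2; lia.
split=> //; have [_ _ hsp] := inBc_spacing hs.
apply/eqP; rewrite eqn_leq; apply/andP.
by split; [exact: inB_spacing_le nc hd hsp | exact: inB_spacing_le nc hsp hd].
Qed.

(** The comparison of the last letters already decides: [add] is 0 for s and positive for the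
    rotation. *)
Lemma not_inRc n c d e k s : n - c < c -> k < n ->
  inB n c d s -> inB n c e (rotr k s) ->
  nth false s n.-1 != nth false s d.-1 ->
  nth false (rotr k s) n.-1 = nth false (rotr k s) e.-1 ->
  inBc n c s /\ ~ inRc n c s.
Proof.
move=> nc kn hd he add0 add1.
have [hs spd] := spacing_eq nc hd; have [hs' spe] := spacing_eq nc he.
have c0 : 0 < c by clear -nc; lia.
have [sz _ _ _ _] := inBP _ _ _ c0 hd; have [sz' _ _ _ _] := inBP _ _ _ c0 he.
split=> // -[_ /(_ k kn hs')]; rewrite /Rshift /Defs.add spd spe /add_d sz sz'.
move: add0 add1; case: (n) kn => [//|m] _ /= add0 add1.
by rewrite !mod0n !subn0 add0 add1 eqxx.
Qed.

Lemma nth_rotr_half h s j : size s = 2 * h -> 0 < h -> j < 2 * h ->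
  nth false (rotr h s) j =
    if j < h then nth false s (j + h) else nth false s (j - h).
Proof.
move=> sz h0 jh; rewrite -per_ext_small ?size_rotr ?sz // per_ext_rotr ?sz; last by lia.
have -> : 2 * h - h = h by lia.
case: ltnP => jlh; first by rewrite per_ext_small ?sz //; lia.
have -> : j + h = j - h + size s by lia.
by rewrite per_ext_per per_ext_small ?sz //; lia.
Qed.

Lemma aperiodic_rotr k s : k <= size s -> aperiodic s -> aperiodic (rotr k s).
Proof. by move=> ks; apply: contra; apply: periodic_rotr. Qed.

Lemma aperiodic_single r u : 1 < size u -> r < size u ->
  (forall j, j < size u -> nth false u j = (j == r)) -> aperiodic u.
Proof.
move=> u1 ru h; apply/negP => /periodic_half[e [e0 e2 e3]].
case: (ltnP (r + e) (size u)) => re.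
  by have := e3 r re; rewrite !h // eqxx; lia.
have := e3 (r - e); rewrite subnK; last by lia.
by rewrite !h //; lia.
Qed.

(* The ones are at cyclic distances d, d, d + D, d + D, so the word is d-periodic at
   its start and (d + D)-periodic at its middle. *)
Definition gap_word d D := mkseq (fun j =>
  [|| j == d.-1, j == (2 * d).-1, j == (3 * d).-1 | j == (4 * d).-1 + D])
  (2 * (2 * d + D)).

Lemma gap_wordE d D j : j < 2 * (2 * d + D) -> nth false (gap_word d D) j =
  [|| j == d.-1, j == (2 * d).-1, j == (3 * d).-1 | j == (4 * d).-1 + D].
Proof. by move=> jn; rewrite nth_mkseq. Qed.

Lemma gap_word_aperiodic d D : 0 < D -> D < d -> aperiodic (gap_word d D).
Proof.
move=> D0 Dd; apply/negP => /periodic_half[e []]; rewrite size_mkseq => e0 e2 e3.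
have one_e j : j + e < 2 * (2 * d + D) -> nth false (gap_word d D) j ->
    [|| j + e == d.-1, j + e == (2 * d).-1, j + e == (3 * d).-1
      | j + e == (4 * d).-1 + D].
  by move=> je; rewrite (e3 j je) gap_wordE.
have one j : j < 2 * (2 * d + D) ->
    j \in [:: d.-1; (2 * d).-1; (3 * d).-1] -> nth false (gap_word d D) j.
  by move=> jn; rewrite gap_wordE // !inE => /or3P[] ->; rewrite ?orbT.
(* The period must send the one at d - 1 to another one. In both cases some one is then sent to 4d -
   1, which is a zero since D > 0. *)
have [ed|ed] : e = d \/ e = 2 * d.
- have /one_e : d.-1 + e < 2 * (2 * d + D) by clear -Dd e2; lia.
  rewrite one ?mem_head //; last by clear -Dd; lia.
  by move=> /(_ isT)/or4P[] /eqP h; clear -D0 Dd e0 e2 h; lia.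
- have /one_e : (3 * d).-1 + e < 2 * (2 * d + D) by clear -D0 Dd ed; lia.
  rewrite one ?inE ?eqxx ?orbT //; last by clear -Dd; lia.
  by move=> /(_ isT)/or4P[] /eqP h; clear -D0 Dd ed h; lia.
- have /one_e : (2 * d).-1 + e < 2 * (2 * d + D) by clear -D0 Dd ed; lia.
  rewrite one ?inE ?eqxx ?orbT //; last by clear -Dd; lia.
  by move=> /(_ isT)/or4P[] /eqP h; clear -D0 Dd ed h; lia.
Qed.

Lemma gap_word_rotr d D j : 0 < D -> D < d -> j < 2 * (2 * d + D) ->
  nth false (rotr (2 * d + D) (gap_word d D)) j =
  [|| j == d.-1 - D, j == (2 * d).-1, j == (3 * d).-1 + D | j == (4 * d).-1 + D].
Proof.
move=> D0 Dd jn; rewrite nth_rotr_half ?size_mkseq //; last by clear -D0; lia.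
by case: ltnP => jh; (rewrite gap_wordE; last by clear -jn jh; lia);
  apply/idP/idP => /or4P[] /eqP h; clear -jn jh D0 Dd h; lia.
Qed.

(** With e = d + D the length is 2d + 2e, the wrapped configuration itself, and half a turn
    exchanges the spacings d and e. D = 1 is used for n = 2 mod 4; D = 2 for n = 4 mod 8, where n is
    not of the form 4d + 2. *)
Lemma gap_word_not_inRc d D : 0 < D -> D < d ->
  exists s, inBc (2 * (2 * d + D)) (3 * d) s /\ ~ inRc (2 * (2 * d + D)) (3 * d) s.
Proof.
move=> D0 Dd; set n := 2 * (2 * d + D); exists (gap_word d D).
have sz : size (gap_word d D) = n by rewrite size_mkseq.
have c0 : 0 < 3 * d by clear -Dd; lia.
have rE j (jn : j < n) := gap_word_rotr D0 Dd jn.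
apply: (@not_inRc _ _ d (d + D) (2 * d + D)).
- by rewrite /n; clear -Dd; lia.
- by rewrite /n; clear -D0; lia.
- apply/(inBP _ _ _ c0); split.
  + by [].
  + by rewrite /n; split; clear -Dd; lia.
  + exact: gap_word_aperiodic.
  + have szd : size (take d (gap_word d D)) = d.
      by rewrite size_takel ?sz /n; clear; lia.
    apply: (@aperiodic_single d.-1); rewrite szd; try (by clear -D0 Dd; lia).
    move=> j jd; rewrite nth_take // gap_wordE; last by clear -jd; lia.
    by apply/idP/idP => [/or4P[]|] /eqP h; clear -jd h; lia.
  + split=> [j jc|].
      rewrite gap_wordE; last by clear -jc; lia.
      rewrite gap_wordE; last by clear -jc; lia.
      by apply/idP/idP => /or4P[] /eqP h; clear -jc D0 h; lia.
    rewrite gap_wordE ?eqxx ?orbT /=; last by clear -Dd; lia.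
    rewrite gap_wordE; last by clear -D0; lia.
    by apply/negP => /or4P[] /eqP h; clear -Dd D0 h; lia.
- apply/(inBP _ _ _ c0); split.
  + by rewrite size_rotr.
  + by rewrite /n; split; clear -Dd; lia.
  + apply: aperiodic_rotr; first by rewrite sz /n; clear; lia.
    exact: gap_word_aperiodic.
  + have szd : size (take (d + D) (rotr (2 * d + D) (gap_word d D))) = d + D.
      by rewrite size_takel ?size_rotr ?sz /n; clear; lia.
    apply: (@aperiodic_single (d.-1 - D)); rewrite szd; try (by clear -D0 Dd; lia).
    move=> j jd; rewrite nth_take // rE; last by rewrite /n; clear -jd; lia.
    by apply/idP/idP => [/or4P[]|] /eqP h; clear -jd Dd h; lia.
  + split=> [j jc|].
      rewrite rE; last by rewrite /n; clear -jc; lia.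
      rewrite rE; last by rewrite /n; clear -jc D0; lia.
      by apply/idP/idP => /or4P[] /eqP h; clear -jc D0 Dd h; lia.
    have -> : (3 * d).-1 + (d + D) = (4 * d).-1 + D by clear -Dd; lia.
    rewrite eq_sym rE ?eqxx ?orbT /=; last by rewrite /n; clear -D0 Dd; lia.
    rewrite rE; last by rewrite /n; clear -D0; lia.
    by apply/negP => /or4P[] /eqP h; clear -Dd D0 h; lia.
- rewrite eq_sym gap_wordE ?eqxx /=; last by clear -Dd; lia.
  rewrite gap_wordE; last by rewrite /n; clear -D0; lia.
  by apply/negP => /or4P[] /eqP; rewrite /n => h; clear -Dd D0 h; lia.
- transitivity false; [|symmetry]; (rewrite rE; last by rewrite /n; clear -D0 Dd; lia);
    by rewrite /n; apply/negbTE/negP => /or4P[] /eqP h; clear -D0 Dd h; lia.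
Qed.

End Sharpness.

(** * Sharpness for lengths divisible by 8 *)

Section SharpnessMod8.
Implicit Types (n c d e j k : nat) (s u : seq bool).

Definition flipped d j := (d <= j < 2 * d) || (3 * d <= j < 4 * d + 2).

(* For odd d this is u^4 1001 with u = 0101...0 of length d; the positions j with
   s_j = s_(j+1) are the ones of gap_word d 2. *)
Definition alternating_word d :=
  mkseq (fun j => odd j (+) flipped d j) (2 * (2 * d + 2)).

Lemma alternating_wordE d j : j < 2 * (2 * d + 2) ->
  nth false (alternating_word d) j = odd j (+) flipped d j.
Proof. by move=> jn; rewrite nth_mkseq. Qed.

Lemma alternating_word_repeat d j : 2 < d -> j.+1 < 2 * (2 * d + 2) ->
  (nth false (alternating_word d) j == nth false (alternating_word d) j.+1) =
  (j.+1 \in [:: d; 2 * d; 3 * d; 4 * d + 2]).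
Proof.
move=> d2 jn; rewrite !alternating_wordE //; last exact: ltnW.
rewrite oddS; have -> : (odd j (+) flipped d j == ~~ odd j (+) flipped d j.+1) =
    (flipped d j != flipped d j.+1).
  by case: (odd j); case: (flipped d j); case: (flipped d j.+1).
have [|jP] := boolP (j.+1 \in _).
  rewrite /flipped !inE => /or4P[] /eqP jE.
  - have -> : (d <= j) = false by lia.
    have -> : (3 * d <= j) = false by lia.
    by rewrite jE leqnn; have -> : d < 2 * d by lia.
  - have -> : d <= j < 2 * d by lia.
    have -> : (3 * d <= j.+1) = false by lia.
    by rewrite jE ltnn andbF.
  - have -> : (j < 2 * d) = false by lia.
    have -> : (3 * d <= j) = false by lia.
    rewrite jE leqnn andbF; have -> : 3 * d < 4 * d + 2 by lia.
    by rewrite orbT.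
  - have -> : 3 * d <= j < 4 * d + 2 by lia.
    rewrite jE ltnn andbF; have -> : (4 * d + 2 < 2 * d) = false by lia.
    by rewrite andbF orbT.
move: jP; rewrite !inE !negb_or => /and4P[j1 j2 j3 j4].
suff -> : flipped d j.+1 = flipped d j by rewrite eqxx.
rewrite /flipped; congr (_ && _ || _ && _).
- by clear -j1; lia.
- by clear -j2; lia.
- by clear -j3; lia.
- by clear -j4; lia.
Qed.

Lemma alternating_word_aperiodic d : 2 < d -> aperiodic (alternating_word d).
Proof.
move=> d2; apply/negP => /periodic_half[e []]; rewrite size_mkseq => e0 e2 e3.
have rep j : (j + e).+1 < 2 * (2 * d + 2) ->
    j.+1 \in [:: d; 2 * d; 3 * d; 4 * d + 2] ->
    (j + e).+1 \in [:: d; 2 * d; 3 * d; 4 * d + 2].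
  move=> je; rewrite -!alternating_word_repeat //; last by clear -je; lia.
  rewrite (e3 j); last by clear -je; lia.
  by rewrite (e3 j.+1) // addSn.
have d1 : d.-1.+1 = d by clear -d2; lia.
have [ed|ed] : e = d \/ e = 2 * d.
- have je : (d.-1 + e).+1 < 2 * (2 * d + 2) by clear -e2 d2; lia.
  have := rep _ je; rewrite d1 mem_head => /(_ isT); rewrite !inE.
  by case/or4P=> /eqP h; clear -h d2 e0 e2; lia.
- have j1 : (3 * d).-1.+1 = 3 * d by clear -d2; lia.
  have je : ((3 * d).-1 + e).+1 < 2 * (2 * d + 2) by clear -ed d2; lia.
  have := rep _ je; rewrite j1 !inE eqxx !orbT => /(_ isT).
  by case/or4P=> /eqP h; clear -h d2 ed; lia.
- have j1 : (2 * d).-1.+1 = 2 * d by clear -d2; lia.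
  have je : ((2 * d).-1 + e).+1 < 2 * (2 * d + 2) by clear -ed d2; lia.
  have := rep _ je; rewrite j1 !inE eqxx !orbT => /(_ isT).
  by case/or4P=> /eqP h; clear -h d2 ed; lia.
Qed.

Lemma alternating_word_rotr d j : 2 < d -> j < 2 * (2 * d + 2) ->
  nth false (rotr (2 * d + 2) (alternating_word d)) j =
  odd j (+) ((d - 2 <= j < 2 * d) || (3 * d + 2 <= j < 4 * d + 2)).
Proof.
move=> d2 jn; rewrite nth_rotr_half ?size_mkseq //; last by clear; lia.
case: ltnP => jh; (rewrite alternating_wordE; last by clear -jn jh; lia);
  rewrite /flipped; congr (_ (+) _).
- by rewrite oddD oddD oddM addbF.
- have -> : (j + (2 * d + 2) < 2 * d) = false by clear; lia.
  have -> : (3 * d <= j + (2 * d + 2)) = (d - 2 <= j) by clear -d2; lia.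
  have -> : (j + (2 * d + 2) < 4 * d + 2) = (j < 2 * d) by clear; lia.
  have -> : (3 * d + 2 <= j) = false by clear -jh d2; lia.
  by rewrite andbF orbF.
- by rewrite oddB // oddD oddM addbF.
- have -> : (d <= j - (2 * d + 2)) = (3 * d + 2 <= j) by clear -jh d2; lia.
  have -> : (j - (2 * d + 2) < 2 * d) = (j < 4 * d + 2) by clear -jh d2; lia.
  have -> : (3 * d <= j - (2 * d + 2)) = false by clear -jn d2; lia.
  have -> : (j < 2 * d) = false by clear -jh; lia.
  by rewrite andbF orbF.
Qed.

Lemma odd_proper_divisor m e : odd m -> 0 < e < m -> e %| m ->
  odd e /\ 2 * e < m.
Proof.
move=> om em /dvdnP[k mE]; move: om; rewrite {1}mE oddM => /andP[ok oe].
split=> //; case: k mE ok => [|[|[|k]]] // mE _; move: em; rewrite mE ?mulSn;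
  by clear; lia.
Qed.

(** Compared with [gap_word d 2], the repeats gain one letter. Within a run, d consecutive steps
    contain one equality and d - 1 changes, an even number since d is odd, so letters at distance d
    agree; likewise for d + 2. *)
Lemma alternating_word_not_inRc d : odd d -> 2 < d ->
  exists s, inBc (2 * (2 * d + 2)) (3 * d + 1) s /\
    ~ inRc (2 * (2 * d + 2)) (3 * d + 1) s.
Proof.
move=> od d2; set n := 2 * (2 * d + 2); exists (alternating_word d).
have sz : size (alternating_word d) = n by rewrite size_mkseq.
have c0 : 0 < 3 * d + 1 by rewrite addn1.
have c1 : (3 * d + 1).-1 = 3 * d by rewrite addn1.
have sE j (jn : j < n) := alternating_wordE jn.
have tE j (jn : j < n) := alternating_word_rotr d2 jn.
have d32 : (3 * d < 2 * d) = false by clear; lia.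
apply: (@not_inRc _ _ d (d + 2) (2 * d + 2)).
- by rewrite /n; clear -d2; lia.
- by rewrite /n; clear -d2; lia.
- apply/(inBP _ _ _ c0); split.
  + by [].
  + by rewrite /n; clear -d2; split; lia.
  + exact: alternating_word_aperiodic.
  + have szd : size (take d (alternating_word d)) = d.
      by rewrite size_takel ?sz /n; clear; lia.
    have uE j : j < d -> nth false (take d (alternating_word d)) j = odd j.
      move=> jd; rewrite nth_take // sE; last by rewrite /n; clear -jd; lia.
      rewrite /flipped; have -> : (d <= j) = false by clear -jd; lia.
      by have -> : (3 * d <= j) = false; [clear -jd; lia | rewrite addbF].
    apply/negP => /periodicP[e []]; rewrite szd => ed edvd e3.
    have [oe _] := odd_proper_divisor od ed edvd.
    have e_d : 0 + e < d by clear -ed; lia.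
    by have := e3 0 e_d; rewrite !uE ?oe //; clear -d2; lia.
  + split=> [j jc|].
      rewrite sE; last by rewrite /n; clear -jc; lia.
      rewrite sE; last by rewrite /n; clear -jc; lia.
      rewrite oddD od addbT addNb -addbN /flipped; congr (_ (+) _).
      have -> : (d <= j + d) by clear; lia.
      have -> : (j + d < 2 * d) = (j < d) by clear; lia.
      have -> : (3 * d <= j + d) = (2 * d <= j) by clear; lia.
      have -> : j + d < 4 * d + 2 by clear -jc; lia.
      have -> : (3 * d <= j) = false by clear -jc; lia.
      by rewrite andbT orbF /= negb_or -!leqNgt -ltnNge andbC.
    rewrite c1 sE; last by rewrite /n; clear; lia.
    rewrite sE; last by rewrite /n; clear; lia.
    rewrite oddD /flipped leqnn d32 andbF.
    have -> : 3 * d < 4 * d + 2 by clear; lia.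
    have -> : 3 * d <= 3 * d + d < 4 * d + 2 by clear; lia.
    by rewrite orbT od addbT; case: (odd _).
- apply/(inBP _ _ _ c0); split.
  + by rewrite size_rotr.
  + by rewrite /n; clear -d2; split; lia.
  + apply: aperiodic_rotr; first by rewrite sz /n; clear; lia.
    exact: alternating_word_aperiodic.
  + have szd : size (take (d + 2) (rotr (2 * d + 2) (alternating_word d))) = d + 2.
      by rewrite size_takel ?size_rotr ?sz /n; clear; lia.
    have vE j : j < d + 2 ->
        nth false (take (d + 2) (rotr (2 * d + 2) (alternating_word d))) j =
        odd j (+) (d - 2 <= j).
      move=> jd; rewrite nth_take // tE; last by rewrite /n; clear -jd; lia.
      have -> : (j < 2 * d) by clear -jd d2; lia.
      have -> : (3 * d + 2 <= j) = false by clear -jd d2; lia.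
      by rewrite andbT orbF.
    apply/negP => /periodicP[e []]; rewrite szd => ed edvd e3.
    have od2 : odd (d + 2) by rewrite oddD od.
    have [oe e2] := odd_proper_divisor od2 ed edvd.
    (* For e < 4 two letters after the phase change at d - 2 are compared; for e >= 4 two letters
       before it, as 2e < d + 2. *)
    have [e4|e4] := ltnP e 4.
      have e_d : d - 2 + e < d + 2 by clear -e4 d2; lia.
      have := e3 _ e_d; rewrite vE; last by clear -d2; lia.
      by rewrite vE // oddD oe leqnn leq_addr; case: (odd _).
    have e_d : 0 + e < d + 2 by clear -ed; lia.
    have := e3 _ e_d; rewrite vE; last by clear; lia.
    rewrite vE // add0n oe.
    have -> : (d - 2 <= 0) = false by clear -d2; lia.
    by have -> : (d - 2 <= e) = false by clear -e4 e2 oe; lia.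
  + split=> [j jc|].
      rewrite tE; last by rewrite /n; clear -jc; lia.
      rewrite tE; last by rewrite /n; clear -jc; lia.
      rewrite oddD oddD od addbF addbT addNb -addbN; congr (_ (+) _).
      have -> : (d - 2 <= j + (d + 2)) by clear; lia.
      have -> : (j + (d + 2) < 2 * d) = (j < d - 2) by clear; lia.
      have -> : (3 * d + 2 <= j + (d + 2)) = (2 * d <= j) by clear; lia.
      have -> : j + (d + 2) < 4 * d + 2 by clear -jc; lia.
      have -> : (3 * d + 2 <= j) = false by clear -jc; lia.
      by rewrite andbT orbF /= negb_or -!leqNgt -ltnNge andbC.
    rewrite c1 tE; last by rewrite /n; clear; lia.
    rewrite tE; last by rewrite /n; clear; lia.
    have -> : 3 * d + (d + 2) = 4 * d + 2 by clear; lia.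
    rewrite d32 ltnn !andbF oddD !oddM od.
    have -> : (3 * d + 2 <= 3 * d) = false by clear; lia.
    have -> : (4 * d + 2 < 2 * d) = false by clear; lia.
    by rewrite andbF.
- rewrite sE; last by rewrite /n; clear; lia.
  rewrite sE; last by rewrite /n; clear -d2; lia.
  have -> : n.-1 = 4 * d + 3 by rewrite /n; clear; lia.
  rewrite /flipped.
  have -> : (4 * d + 3 < 2 * d) = false by clear; lia.
  have -> : (4 * d + 3 < 4 * d + 2) = false by clear; lia.
  have -> : (d <= d.-1) = false by clear -d2; lia.
  have -> : (3 * d <= d.-1) = false by clear -d2; lia.
  have -> : odd d.-1 = false by move: od; case: (d) => //= m /negbTE.
  by rewrite !andbF oddD oddM.
- rewrite tE; last by rewrite /n; clear; lia.
  rewrite tE; last by rewrite /n; clear -d2; lia.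
  have -> : n.-1 = 4 * d + 3 by rewrite /n; clear; lia.
  have -> : (d + 2).-1 = d + 1 by clear; lia.
  have -> : (4 * d + 3 < 2 * d) = false by clear; lia.
  have -> : (4 * d + 3 < 4 * d + 2) = false by clear; lia.
  have -> : d - 2 <= d + 1 < 2 * d by clear -d2; lia.
  by rewrite !andbF !oddD od.
Qed.

End SharpnessMod8.

(** * Small lengths *)

Section ExhaustiveCheck.
Implicit Types (n c d e k m : nat) (s t x : seq bool).

Fixpoint words m : seq (seq bool) :=
  if m is m'.+1 then map (cons false) (words m') ++ map (cons true) (words m')
  else [:: [::]].

Lemma mem_words m x : size x = m -> x \in words m.
Proof.
elim: m x => [|m IH] [|b x] //= [/IH xm]; rewrite mem_cat.
by case: b; rewrite map_f ?orbT.
Qed.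

(** A word of B(n,c,d) is fixed by its first d and its last n - c - d letters, so 2^(n - c)
    candidates are enumerated. *)
Definition build c d x :=
  let p := take (c + d).-1 (flatten (nseq (c + d) (take d x))) in
  rcons p (~~ nth false p c.-1) ++ drop d x.

(* A conditional, since vm_compute would always evaluate both sides of &&. *)
Definition has_run c e t :=
  if take c.-1 t == take c.-1 (drop e t) then aperiodic (take e t) else false.

Definition spacing_check n c d e :=
  all (fun x => let s := build c d x in
    if aperiodic (take d s) then
      all (fun k => ~~ has_run c e (rotr k s)) (iota 0 n)
    else true) (words (n - c)).

Lemma inB_build n c d s : 0 < c -> inB n c d s ->
  s = build c d (take d s ++ drop (c + d) s).
Proof.
move=> c0 /(inBP _ _ _ c0)[sz [d0 d1 d2] _ _ [h1 h2]].
have sd : size (take d s) = d by rewrite size_takel; lia.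
have cdn : c + d <= n by clear -d0 d1; lia.
rewrite /build take_size_cat // drop_size_cat //.
set p := take _ _.
have sp : size p = (c + d).-1.
  rewrite size_takel // size_flatten_nseq sd.
  by rewrite (leq_trans (leq_pred _)) // leq_pmulr.
have h3 : forall j, j < (c + d).-1 -> nth false s j = nth false s (j %% d).
  by apply: step_modn => j jd; apply: h1; clear -jd d0; lia.
have np j : j < (c + d).-1 -> nth false p j = nth false s j.
  move=> jm; rewrite nth_take // nth_flatten_nseq sd.
    by rewrite nth_take ?ltn_mod // -h3.
  by rewrite (leq_trans jm) // (leq_trans (leq_pred _)) // leq_pmulr.
rewrite -[LHS](cat_take_drop (c + d) s); congr (_ ++ _).
have m1 : (c + d).-1.+1 = c + d by clear -c0; lia.
apply: (@eq_from_nth _ false) => [|j].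
  by rewrite size_rcons sp m1 size_takel // sz.
rewrite size_takel ?sz // => jcd; rewrite nth_take // nth_rcons sp.
case: (ltngtP j (c + d).-1) => jm; first by rewrite np.
  by move: jm jcd; clear; lia.
rewrite jm np; last by clear -c0 d0; lia.
have -> : (c + d).-1 = c.-1 + d by clear -c0; lia.
by move: h2; case: (nth _ _ _); case: (nth _ _ _).
Qed.

Lemma spacing_checkP n c d e k s : spacing_check n c d e -> 0 < c -> k < n ->
  inB n c d s -> ~~ inB n c e (rotr k s).
Proof.
move=> chk c0 kn hd; apply/negP => he.
have [sz [d0 d1 d2] _ ap _] := inBP _ _ _ c0 hd.
have [szt [e0 e1 e2] _ ap' [run _]] := inBP _ _ _ c0 he.
have cdn : c + d <= n by clear -d0 d1; lia.
have := allP chk (take d s ++ drop (c + d) s).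
cbv beta zeta; rewrite -(inB_build c0 hd) ap => /(_ (mem_words _)).
rewrite size_cat size_takel ?size_drop ?sz; last by clear -cdn; lia.
have -> : d + (n - (c + d)) = n - c by clear -cdn; lia.
move=> /(_ erefl)/allP/(_ k); rewrite mem_iota => /(_ kn).
rewrite /has_run ap'; case: eqP => // -[]; apply: (@eq_from_nth _ false) => [|j].
  by rewrite !size_takel ?size_drop ?szt //; clear -e0 e1 c0; lia.
rewrite size_takel => [jc|]; last by rewrite szt; clear -e0 e1; lia.
by rewrite !nth_take // nth_drop addnC; apply: run; clear -jc; lia.
Qed.

(** Argument and computation are combined pair by pair, since (20,13) uses both. *)
Lemma inRc_by_spacings n c s : 2 * (n - c) <= n ->
  (forall d e, 0 < d <= n - c -> 0 < e <= n - c -> d != e ->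
     no_wrap_cond n (n - c) d e \/ spacing_check n c d e) ->
  inBc n c s -> inRc n c s.
Proof.
move=> wn cases hs; have [nc c0 _] := inBc_spacing hs.
apply: inRc_of_spacing wn _ hs => d e k kn hd he.
have [_ [d0 d1 _] _ _ _] := inBP _ _ _ c0 hd.
have [_ [e0 e1 _] _ _ _] := inBP _ _ _ c0 he.
apply/eqP; apply: contraT => nde.
have [||cond|chk] := cases d e _ _ nde; rewrite ?d0 ?e0 //.
  by rewrite (spacing_rotr cond nc c0 kn hd he) eqxx in nde.
by have := spacing_checkP chk c0 kn hd; rewrite he.
Qed.

Lemma no_wrap_inRc n c s : 2 * (n - c) <= n ->
  (forall d e, no_wrap_cond n (n - c) d e) -> inBc n c s -> inRc n c s.
Proof. by move=> wn cond; apply: inRc_by_spacings => // *; left. Qed.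

Definition all_spacings_check n c :=
  all (fun d => all (fun e => if d == e then true else spacing_check n c d e)
    (iota 1 (n - c))) (iota 1 (n - c)).

Lemma checked_inRc n c s : all_spacings_check n c -> 2 * (n - c) <= n ->
  inBc n c s -> inRc n c s.
Proof.
move=> chk wn; apply: inRc_by_spacings => // d e /andP[d0 d1] /andP[e0 e1] nde.
have mem_iota1 i : 0 < i -> i <= n - c -> i \in iota 1 (n - c).
  by rewrite mem_iota add1n ltnS => -> ->.
have := allP (allP chk d (mem_iota1 _ d0 d1)) e (mem_iota1 _ e0 e1).
by rewrite (negbTE nde); right.
Qed.

(** With n - c = m + 1, (5,3) and (9,6) are m = 1, 2 of n = 4m + 1, and (8,5) is m = 2 of n = 4m.
    (20,13) is m = 2 of n = 8m + 4. *)
Lemma small_checks : [&& all_spacings_check 5 3, all_spacings_check 8 5,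
  all_spacings_check 9 6, spacing_check 20 13 6 7 & spacing_check 20 13 7 6].
Proof. by vm_compute. Qed.

Lemma small_inRc n c s :
  (n, c) \in [:: (5, 3); (8, 5); (9, 6); (20, 13)] -> inBc n c s -> inRc n c s.
Proof.
have /and5P[k5 k8 k9 k67 k76] := small_checks.
rewrite !inE => /or4P[] /eqP[-> ->].
- exact: checked_inRc k5 isT.
- exact: checked_inRc k8 isT.
- exact: checked_inRc k9 isT.
apply: inRc_by_spacings; first exact: isT.
move=> d e /andP[_ d7] /andP[_ e7] nde.
have [lt6|] := boolP ((d < 6) || (e < 6)); first by clear -lt6; left; apply: Or33.
rewrite negb_or -!leqNgt => /andP[d6 e6]; right.
have [[-> ->]|[-> ->]] : (d = 6 /\ e = 7) \/ (d = 7 /\ e = 6).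
- by clear -d6 e6 d7 e7 nde; lia.
- exact: k67.
- exact: k76.
Qed.

End ExhaustiveCheck.

Theorem theorem1 :
  (forall (n c : nat) (s : seq bool),
      1 <= n -> n./2 <= c -> inBc n c s -> (3 * n) %/ 4 <= c ->
      inRc n c s /\ nlc_per s = nlc s + add n c s)
  /\
  (forall n : nat,
      1 <= n -> ~~ odd n -> n != 4 -> n != 12 ->
      (forall (c : nat) (s : seq bool),
          n./2 <= c -> c0_even n <= c -> inBc n c s -> inRc n c s)
      /\
      (n./2 <= c0_even n - 1 ->
          exists s : seq bool, inBc n (c0_even n - 1) s /\ ~ inRc n (c0_even n - 1) s)).
Proof.
split=> [n c s n0 _ hs c34 | n n0 en n4 n12].
  split; last exact: nlc_inBc.
  have [_ c0 _] := inBc_spacing hs.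
  have [small|] := boolP ((n, c) \in [:: (5, 3); (8, 5); (9, 6); (20, 13)]).
    exact: small_inRc.
  rewrite !inE !xpair_eqE => nsmall; apply: no_wrap_inRc => // [|d e].
    by clear -n0 c34 c0; lia.
  (* From c >= floor(3n/4) follows 4(n - c) <= n + 3; the remaining equality forces n = 4m + 1. *)
  have [h|h] := leqP (4 * (n - c)) (n + 2); first exact: Or31.
  have [nE cE] : n = 4 * (n - c).-1 + 1 /\ c = 3 * (n - c).-1.
    by clear -n0 c34 c0 h; lia.
  apply: Or32; exists (n - c).-1; split; last by apply: Or31; clear -nE cE c0; lia.
  by move: nsmall; clear -nE cE c0; lia.
split=> [c s _ hc hs|].
  have [_ c0 _] := inBc_spacing hs.
  have [small|] := boolP ((n, c) \in [:: (5, 3); (8, 5); (9, 6); (20, 13)]).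
    exact: small_inRc.
  rewrite !inE !xpair_eqE => nsmall.
  have [h|h] := leqP (4 * (n - c)) (n + 2).
    by apply: no_wrap_inRc => // [|d e]; [clear -n0 en h; lia | apply: Or31].
  have [h8|[h4 n12']] : 8 %| n \/ n %% 8 = 4 /\ 12 < n.
    move: hc; rewrite /c0_even /dvdn; case: (n %% 8 =P 0) => [_|h8]; first by left.
    case: (n %% 8 =P 4) => [h4|h4] hc; first by right; clear -h4 n4 n12; lia.
    by move: hc h h8 h4; clear -en; lia.
  - have [k nE] : exists k, n = 8 * k by exists (n %/ 8); rewrite mulnC divnK.
    have cE : c = 6 * k - 1.
      by move: hc; rewrite /c0_even nE modnMr eqxx; clear -h nE n0; lia.
    have k1 : 1 < k by move: nsmall; clear -nE cE n0; lia.
    apply: no_wrap_inRc => // [|d e]; first by clear -nE cE k1; lia.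
    by apply: Or32; exists (2 * k); split; [|apply: Or32]; clear -nE cE k1; lia.
  - have [k nE] : exists k, n = 8 * k + 4.
      by exists (n %/ 8); rewrite mulnC {1}(divn_eq n 8) h4.
    (* Both c0 and c0 + 1 escape the counting bound: the first is the case n = 8m + 4, the second
       the case n = 4m with m = 2k + 1. *)
    have cE : c = 6 * k + 1 \/ c = 6 * k + 2.
      by move: hc; rewrite /c0_even h4 /=; clear -h nE n0; lia.
    apply: no_wrap_inRc => // [|d e]; first by clear -nE cE n12'; lia.
    apply: Or32; case: cE => cE.
      exists k; split; last by apply: Or33; clear -nE cE; lia.
      by move: nsmall; clear -nE cE n12'; lia.
    by exists (2 * k + 1); split; [|apply: Or32]; clear -nE cE n12'; lia.
rewrite /c0_even; case: eqP => [h8|h8]; [|case: eqP => h4] => hn.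
(* For n = 8 the spacing d = n/4 - 1 = 1 is too small for [alternating_word_not_inRc]. *)
- have [n8|n8] := eqVneq n 8.
    rewrite n8; exists [:: false; false; false; false; true; false; false; true].
    split; first by vm_compute.
    by case=> _ /(_ 4 isT); vm_compute => /(_ isT).
  pose k := n %/ 8; have nk : n = 8 * k by rewrite /k; clear -h8; lia.
  have k2 : 1 < k by clear -nk n0 n8; lia.
  have [//||s hs] := @alternating_word_not_inRc (2 * k).-1; try by clear -k2; lia.
  exists s; move: hs.
  have -> : 2 * (2 * (2 * k).-1 + 2) = n by clear -nk k2; lia.
  by have -> : 3 * (2 * k).-1 + 1 = 3 * n %/ 4 - 1 - 1 by clear -nk k2; lia.
- pose k := n %/ 8; have nk : n = 8 * k + 4 by rewrite /k; clear -h4; lia.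
  have k2 : 1 < k by clear -nk n4 n12; lia.
  have [//||s hs] := @gap_word_not_inRc (2 * k) 2; first by clear -k2; lia.
  exists s; move: hs.
  have -> : 2 * (2 * (2 * k) + 2) = n by clear -nk; lia.
  by have -> : 3 * (2 * k) = 3 * n %/ 4 - 2 - 1 by clear -nk; lia.
(* For n = 6 the spacing d = (n - 2)/4 = 1 does not exceed D = 1. *)
- have [n6|n6] := eqVneq n 6.
    rewrite n6; exists [:: true; true; true; false; true; false].
    split; first by vm_compute.
    by case=> _ /(_ 3 isT); vm_compute => /(_ isT).
  pose d := n %/ 4; have nd : n = 4 * d + 2 by rewrite /d; clear -h8 h4 en; lia.
  have d2 : 1 < d by clear -nd n6 hn; lia.
  have [//||s hs] := @gap_word_not_inRc d 1; first by [].
  exists s; move: hs.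
  have -> : 2 * (2 * d + 1) = n by clear -nd; lia.
  by have -> : 3 * d = 3 * n %/ 4 - 1 by clear -nd; lia.
Qed.
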